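(* Let $k\ge2$ and let $T\in\mathbb{R}^{n\times\cdots\times n}$ be a symmetric order-$k$ tensor that is $(\mu_1,\mu_2)$-incoherent. Assume $A=\operatorname{unfold}_1(T)\in\mathbb{R}^{n\times n^{k-1}}$ has rank $r$ and condition number $\kappa$. Let $\hat T$ be the output of the following procedure: (i) form the wedge matrix $Z$ of $A$ at rate $p$, let $\hat U\in\mathbb{R}^{n\times r}$ consist of orthonormal eigenvectors of $Z$ for its $r$ largest eigenvalues and $Q=\hat U\hat U^\top$; (ii) independently of the wedge samples, observe each entry of $T$ independently with probability $q$, let $\tilde T$ be the tensor equal to $T$ on observed entries and $0$ elsewhere, and $Y=\operatorname{unfold}_1(q^{-1}\tilde T)$; (iii) let $\hat T$ be the order-$k$ tensor whose mode-1 unfolding is $QY(Q\otimes\cdots\otimes Q)$ ($k-1$ Kronecker factors). For any $a\ge2$ there exist universal constants $C_0,C>0$ such that if $p\ge \frac{C_0\kappa^4a\mu_1\mu_2r^2\log n}{n^k}$ and $q\ge\frac{a(k-1)\log n}{n^k}$, then with probability $1-O(n^{-a})$, \[ \|T-\hat T\|_F\le C\left(k\sqrt r\,\kappa^2\sqrt{\frac{a\mu_1\mu_2r^2\log n}{pn^k}}+2^kr^{1.5+k/2}\kappa^{2k}\sqrt{\frac{a(k-1)\mu_1^{k+1}\mu_2\log n}{qn^k}}\right)\|T\|_F . \]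
   Context: The mode-1 unfolding $\operatorname{unfold}_1(T)\in\mathbb{R}^{n\times n^{k-1}}$ has entries $[\operatorname{unfold}_1(T)]_{i_1,(i_2,\dots,i_k)}=T_{i_1,\dots,i_k}$, with the column multi-index $(i_2,\dots,i_k)$ identified with $e_{i_2}\otimes\cdots\otimes e_{i_k}$, so that right multiplication by $Q\otimes\cdots\otimes Q$ is well defined. A tensor $T$ is $(\mu_1,\mu_2)$-incoherent if for every mode $j$, the compact SVD $\operatorname{unfold}_j(T)=U^{(j)}\Sigma^{(j)}(V^{(j)})^\top$ satisfies $\max_i\|U^{(j)}_{i,\cdot}\|_2^2\le\mu_1r_j/n_j$ and $\max_i\|V^{(j)}_{i,\cdot}\|_2^2\le\mu_2r_j/m_j$, where $r_j$ is the rank of the unfolding and $m_j=\prod_{\ell\ne j}n_\ell$. Condition number: $\kappa=\sigma_1(A)/\sigma_r(A)$. Wedge matrix of $A\in\mathbb{R}^{n\times m}$ at rate $p$: each triple of $\mathcal W=\{(i,\ell,j):1\le i\le j\le n,\ \ell\in[m]\}$ is sampled independently with probability $p$ (giving $\tilde{\mathcal W}$); with $Z_{i\ell j}=p^{-1}A_{i\ell}A_{j\ell}e_ie_j^\top\mathbf 1\{(i,\ell,j)\in\tilde{\mathcal W}\}$, $Z=\sum_{i<j,\ell}(Z_{i\ell j}+Z_{i\ell j}^\top)+\sum_{i,\ell}Z_{i\ell i}$. *)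

(* Defs.v *)
From HB Require Import structures.
From mathcomp Require Import all_boot all_order all_algebra all_fingroup.
From mathcomp Require Import all_classical all_reals all_analysis.
Set Implicit Arguments. Unset Strict Implicit. Unset Printing Implicit Defensive.
Import Order.TTheory GRing.Theory Num.Theory.
Local Open Scope ring_scope.

Definition mindex (k n : nat) := {ffun 'I_k -> 'I_n}.

Definition ncol (k n : nat) : nat := #|{ffun 'I_k.-1 -> 'I_n}|.

Definition insert_at (k n : nat) (j : 'I_k) (i : 'I_n) (J : {ffun 'I_k.-1 -> 'I_n})
  : mindex k n :=
  [ffun l => match unlift j l with None => i | Some l' => J l' end].

Definition drop_at (k n : nat) (j : 'I_k) (f : mindex k n) : {ffun 'I_k.-1 -> 'I_n} :=
  [ffun l' => f (lift j l')].

Definition unfold (R : realType) (k n : nat) (j : 'I_k) (T : mindex k n -> R)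
  : 'M[R]_(n, ncol k n) :=
  \matrix_(i < n, c < ncol k n) T (insert_at j i (enum_val c)).

Definition fold (R : realType) (k n : nat) (j : 'I_k) (M : 'M[R]_(n, ncol k n))
  : mindex k n -> R :=
  fun f => M (f j) (enum_rank (drop_at j f)).

(* mode 1 (index 0), given k >= 2 *)
Definition mode1 (k : nat) (hk : (1 < k)%N) : 'I_k := Ordinal (ltnW hk).

Definition symmetric_tensor (R : realType) (k n : nat) (T : mindex k n -> R) : Prop :=
  forall (s : 'S_k) (f : mindex k n), T [ffun l => f (s l)] = T f.

Definition frob (R : realType) (k n : nat) (T : mindex k n -> R) : R :=
  Num.sqrt (\sum_(f : mindex k n) T f ^+ 2).

Definition compact_svd (R : realType) (a b r : nat) (M : 'M[R]_(a, b))
  (U : 'M[R]_(a, r)) (s : 'rV[R]_r) (V : 'M[R]_(b, r)) : Prop :=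
  [/\ U^T *m U = 1%:M, V^T *m V = 1%:M,
      (forall i, 0 < s 0 i),
      (forall i j : 'I_r, (i <= j)%N -> s 0 j <= s 0 i)
    & M = U *m diag_mx s *m V^T].

Definition row_norm2 (R : realType) (a r : nat) (U : 'M[R]_(a, r)) (i : 'I_a) : R :=
  \sum_(c < r) U i c ^+ 2.

(* (mu1,mu2)-incoherence; here n_j = n and m_j = n^(k-1) = ncol k n *)
Definition incoherent (R : realType) (k n : nat) (T : mindex k n -> R) (mu1 mu2 : R)
  : Prop :=
  forall j : 'I_k,
    exists (U : 'M[R]_(n, \rank (unfold j T))) (s : 'rV[R]_(\rank (unfold j T)))
           (V : 'M[R]_(ncol k n, \rank (unfold j T))),
      compact_svd (unfold j T) U s V /\
      (forall i, row_norm2 U i <= mu1 * (\rank (unfold j T))%:R / n%:R) /\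
      (forall i, row_norm2 V i <= mu2 * (\rank (unfold j T))%:R / (ncol k n)%:R).

Definition cond_number (R : realType) (a b : nat) (M : 'M[R]_(a, b)) (kappa : R) : Prop :=
  exists (U : 'M[R]_(a, \rank M)) (s : 'rV[R]_(\rank M)) (V : 'M[R]_(b, \rank M)),
    compact_svd M U s V /\
    forall i j : 'I_(\rank M), val i = 0%N -> val j = (\rank M).-1 -> kappa = s 0 i / s 0 j.

Definition wsample (n m : nat) := {ffun 'I_n * 'I_m * 'I_n -> bool}.

Definition wedge_term (R : realType) (n m : nat) (p : R) (A : 'M[R]_(n, m))
  (w : wsample n m) (i : 'I_n) (l : 'I_m) (j : 'I_n) : 'M[R]_n :=
  (p^-1 * A i l * A j l * (w (i, l, j))%:R) *: delta_mx i j.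

Definition wedge_matrix (R : realType) (n m : nat) (p : R) (A : 'M[R]_(n, m))
  (w : wsample n m) : 'M[R]_n :=
  \sum_(i < n) \sum_(j < n | (i < j)%N) \sum_(l < m)
      (wedge_term p A w i l j + (wedge_term p A w i l j)^T)
  + \sum_(i < n) \sum_(l < m) wedge_term p A w i l i.

Definition top_eigvecs (R : realType) (n r : nat) (Z : 'M[R]_n) (U : 'M[R]_(n, r)) : Prop :=
  exists (V : 'M[R]_n) (lam : 'rV[R]_n),
    [/\ V^T *m V = 1%:M, V^T *m Z *m V = diag_mx lam,
        (forall i j : 'I_n, (i <= j)%N -> lam 0 j <= lam 0 i)
      & forall (i : 'I_n) (c : 'I_r) (c' : 'I_n), val c = val c' -> U i c = V i c'].

(* the matrix Q (x) ... (x) Q (k-1 factors) with rows/columns indexed by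
   (k-1)-multi-indices (identified with e_{i2} (x) ... (x) e_{ik}) *)
Definition kron_pow (R : realType) (k n : nat) (Q : 'M[R]_n) : 'M[R]_(ncol k n) :=
  \matrix_(c' < ncol k n, c < ncol k n)
     \prod_(l < k.-1) Q (enum_val c' l) (enum_val c l).

Definition esample (k n : nat) := {ffun mindex k n -> bool}.

Definition estimator (R : realType) (k n r : nat) (hk : (1 < k)%N) (T : mindex k n -> R)
  (q : R) (U : 'M[R]_(n, r)) (e : esample k n) : mindex k n -> R :=
  let Q := U *m U^T in
  let Y := unfold (mode1 hk) (fun f => q^-1 * (if e f then T f else 0)) in
  fold (mode1 hk) (Q *m Y *m kron_pow k Q).

Definition bern (R : realType) (X : finType) (p : R) (s : {ffun X -> bool}) : R :=
  \prod_(x : X) (if s x then p else 1 - p).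

Definition prob2 (R : realType) (X Y : finType) (p q : R)
  (E : {ffun X -> bool} -> {ffun Y -> bool} -> Prop) : R :=
  \sum_(w : {ffun X -> bool}) \sum_(e : {ffun Y -> bool})
     bern p w * bern q e * (if `[< E w e >] then 1 else 0).

(* Main.v *)
(** Write [A] for the mode-1 unfolding and [Z] for the wedge matrix, so that
    [Z = A A^T + E] with [E] a sum of independent centred matrices.

    The operator norm of [E] is controlled by its trace moments. Convexity of
    [tr x^(2s)] lets one replace [E] by [E - E'] for an independent copy [E'],
    whose signs may be randomised; a trapezoidal inequality for traces then gives
    a Khintchine bound in terms of a diagonal variance proxy, the moments of which
    come from a scalar exponential moment. The same argument with [|x|^(2s)]
    gives dimension-free tails for sums of independent vectors.

    Weyl's inequality and the Davis-Kahan theorem in Frobenius norm bound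
    [(1 - Q) U], hence the bias [T - (Q (x) ... (x) Q) T], which telescopes over
    the modes. For the sampling noise the rows of [Q] have to be small as well.
    This is a leave-one-out argument: zeroing row and column [i] of [E] gives a
    projection [Q_i] that is independent of row [i] of [E] and close to [Q], so the
    vector tail bounds row [i] of [E Q_i], thus of [E Q], and row [i] of
    [Z Q = A A^T Q + E Q] dominates row [i] of [Q]. *)
Require Import Defs.
Require Import Defs.
From HB Require Import structures.
From mathcomp Require Import all_boot all_order all_algebra all_fingroup.
From mathcomp Require Import all_classical all_reals all_analysis.
From mathcomp Require Import ring lra zify.
From mathcomp Require Import complex.
Import Order.TTheory GRing.Theory Num.Theory.
Set Implicit Arguments.
Unset Strict Implicit.
Unset Printing Implicit Defensive.
Local Open Scope ring_scope.

Ltac nonneg := repeat first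
  [ done | exact: sqr_ge0 | exact: expR_ge0 | exact: ler0n | exact: sqrtr_ge0
  | by apply: ltW | apply: exprn_ge0 | apply: divr_ge0 | apply: mulr_ge0
  | apply: addr_ge0 | apply: sumr_ge0 => ? _ ].

Lemma gt0_le1W (R : numDomainType) (p : R) : 0 < p <= 1 -> 0 <= p <= 1.
Proof. by case/andP => /ltW->. Qed.

Section FrobeniusNorm.
Variable R : rcfType.
Implicit Types a b c : nat.

Definition fdot a b (M N : 'M[R]_(a, b)) : R := \sum_i \sum_j M i j * N i j.

Definition sqnorm a b (M : 'M[R]_(a, b)) : R := fdot M M.

Definition fnorm a b (M : 'M[R]_(a, b)) : R := Num.sqrt (sqnorm M).

Lemma fdot_trace a b (M N : 'M[R]_(a, b)) : fdot M N = \tr (M *m N^T).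
Proof.
rewrite /fdot /mxtrace; apply: eq_bigr => i _; rewrite mxE.
by apply: eq_bigr => j _; rewrite mxE.
Qed.

Lemma fdotC a b (M N : 'M[R]_(a, b)) : fdot M N = fdot N M.
Proof. by apply: eq_bigr => i _; apply: eq_bigr => j _; rewrite mulrC. Qed.

Lemma fdotDl a b (M N P : 'M[R]_(a, b)) : fdot (M + N) P = fdot M P + fdot N P.
Proof. by rewrite !fdot_trace mulmxDl raddfD. Qed.

Lemma fdotNl a b (M N : 'M[R]_(a, b)) : fdot (- M) N = - fdot M N.
Proof. by rewrite !fdot_trace mulNmx raddfN. Qed.

Lemma fdotZl a b x (M N : 'M[R]_(a, b)) : fdot (x *: M) N = x * fdot M N.
Proof. by rewrite !fdot_trace -scalemxAl mxtraceZ. Qed.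

Lemma fdotDr a b (M N P : 'M[R]_(a, b)) : fdot P (M + N) = fdot P M + fdot P N.
Proof. by rewrite fdotC fdotDl !(fdotC P). Qed.

Lemma fdotNr a b (M N : 'M[R]_(a, b)) : fdot N (- M) = - fdot N M.
Proof. by rewrite fdotC fdotNl fdotC. Qed.

Lemma fdotZr a b x (M N : 'M[R]_(a, b)) : fdot N (x *: M) = x * fdot N M.
Proof. by rewrite fdotC fdotZl fdotC. Qed.

Lemma fdot0r a b (M : 'M[R]_(a, b)) : fdot M 0 = 0.
Proof. by rewrite -(scale0r 0) fdotZr mul0r. Qed.

Lemma fdot_mull a b c (A : 'M[R]_(a, b)) (M : 'M[R]_(b, c)) N :
  fdot (A *m M) N = fdot M (A^T *m N).
Proof. by rewrite !fdot_trace trmx_mul trmxK -mulmxA mxtrace_mulC mulmxA. Qed.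

Lemma sqnormE a b (M : 'M[R]_(a, b)) : sqnorm M = \sum_i \sum_j M i j ^+ 2.
Proof. by apply: eq_bigr => i _; apply: eq_bigr => j _; rewrite expr2. Qed.

Lemma sqnorm_rV a (u : 'rV[R]_a) : sqnorm u = \sum_i u 0 i ^+ 2.
Proof. by rewrite sqnormE big_ord1. Qed.

Lemma sqnorm_ge0 a b (M : 'M[R]_(a, b)) : 0 <= sqnorm M.
Proof. by rewrite sqnormE; do 2!apply: sumr_ge0 => ? _; exact: sqr_ge0. Qed.

Lemma sqnorm_trace a b (M : 'M[R]_(a, b)) : sqnorm M = \tr (M *m M^T).
Proof. exact: fdot_trace. Qed.

Lemma sqnormT a b (M : 'M[R]_(a, b)) : sqnorm M^T = sqnorm M.
Proof. by rewrite !sqnorm_trace trmxK mxtrace_mulC. Qed.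

Lemma sqnormZ a b x (M : 'M[R]_(a, b)) : sqnorm (x *: M) = x ^+ 2 * sqnorm M.
Proof. by rewrite /sqnorm fdotZl fdotZr mulrA expr2. Qed.

Lemma sqnormN a b (M : 'M[R]_(a, b)) : sqnorm (- M) = sqnorm M.
Proof. by rewrite /sqnorm fdotNl fdotNr opprK. Qed.

Lemma sqnorm0 a b : sqnorm (0 : 'M[R]_(a, b)) = 0.
Proof. exact: fdot0r. Qed.

Lemma sqnormD a b (M N : 'M[R]_(a, b)) :
  sqnorm (M + N) = sqnorm M + 2 * fdot M N + sqnorm N.
Proof. by rewrite /sqnorm fdotDl !fdotDr (fdotC N M); ring. Qed.

Lemma sqnormB a b (M N : 'M[R]_(a, b)) :
  sqnorm (M - N) = sqnorm M - 2 * fdot M N + sqnorm N.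
Proof. by rewrite sqnormD fdotNr sqnormN; ring. Qed.

Lemma sqnorm_eq0 a b (M : 'M[R]_(a, b)) : sqnorm M = 0 -> M = 0.
Proof.
rewrite sqnormE => /psumr_eq0P sum0; apply/matrixP => i j; rewrite mxE.
have /psumr_eq0P row0 : \sum_j M i j ^+ 2 = 0.
  by apply: sum0 => // *; apply: sumr_ge0 => *; exact: sqr_ge0.
by apply/eqP; rewrite -sqrf_eq0 row0 // => *; exact: sqr_ge0.
Qed.

Lemma sqnorm_gt0 a b (M : 'M[R]_(a, b)) : M != 0 -> 0 < sqnorm M.
Proof.
by move=> M0; rewrite lt_def sqnorm_ge0 andbT; apply: contra_neq M0; exact: sqnorm_eq0.
Qed.

Lemma fdot_cauchy_schwarz a b (M N : 'M[R]_(a, b)) :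
  fdot M N ^+ 2 <= sqnorm M * sqnorm N.
Proof.
have [->|/sqnorm_gt0 N_gt0] := eqVneq N 0; first by rewrite fdot0r sqnorm0 expr0n mulr0.
have := sqnorm_ge0 (sqnorm N *: M - fdot M N *: N).
rewrite sqnormB !sqnormZ fdotZl fdotZr => residual_ge0.
by rewrite -subr_ge0 -(pmulr_rge0 _ N_gt0); lra.
Qed.

Lemma fnorm_ge0 a b (M : 'M[R]_(a, b)) : 0 <= fnorm M.
Proof. exact: sqrtr_ge0. Qed.

Lemma fnorm_sq a b (M : 'M[R]_(a, b)) : fnorm M ^+ 2 = sqnorm M.
Proof. by rewrite sqr_sqrtr ?sqnorm_ge0. Qed.

Lemma fnorm0 a b : fnorm (0 : 'M[R]_(a, b)) = 0.
Proof. by rewrite /fnorm sqnorm0 sqrtr0. Qed.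

Lemma fnorm_le a b (M : 'M[R]_(a, b)) t : 0 <= t -> (fnorm M <= t) = (sqnorm M <= t ^+ 2).
Proof. by move=> t0; rewrite -fnorm_sq ler_pXn2r // nnegrE fnorm_ge0. Qed.

Lemma fnorm_le_fnorm a b c d (M : 'M[R]_(a, b)) (N : 'M[R]_(c, d)) :
  (fnorm M <= fnorm N) = (sqnorm M <= sqnorm N).
Proof. by rewrite fnorm_le ?fnorm_ge0 // fnorm_sq. Qed.

Lemma fdot_le_fnorm a b (M N : 'M[R]_(a, b)) : fdot M N <= fnorm M * fnorm N.
Proof.
apply: le_trans (ler_norm _) _.
rewrite -(ler_pXn2r (n := 2)) ?nnegrE ?mulr_ge0 ?fnorm_ge0 //.
by rewrite exprMn !fnorm_sq real_normK ?num_real // fdot_cauchy_schwarz.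
Qed.

Lemma fnormD a b (M N : 'M[R]_(a, b)) : fnorm (M + N) <= fnorm M + fnorm N.
Proof.
rewrite fnorm_le ?addr_ge0 ?fnorm_ge0 // sqnormD -!fnorm_sq.
by have := fdot_le_fnorm M N; lra.
Qed.

Lemma fnormN a b (M : 'M[R]_(a, b)) : fnorm (- M) = fnorm M.
Proof. by rewrite /fnorm sqnormN. Qed.

Lemma fnormB a b (M N : 'M[R]_(a, b)) : fnorm (M - N) <= fnorm M + fnorm N.
Proof. by rewrite -(fnormN N) fnormD. Qed.

Lemma fnormT a b (M : 'M[R]_(a, b)) : fnorm M^T = fnorm M.
Proof. by rewrite /fnorm sqnormT. Qed.

Lemma sqnorm_rows a b (M : 'M[R]_(a, b)) : sqnorm M = \sum_i sqnorm (row i M).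
Proof.
rewrite sqnormE; apply: eq_bigr => i _; rewrite sqnorm_rV.
by apply: eq_bigr => j _; rewrite mxE.
Qed.

Lemma sqnorm_cols a b (M : 'M[R]_(a, b)) : sqnorm M = \sum_j sqnorm (col j M).
Proof.
rewrite -sqnormT sqnorm_rows; apply: eq_bigr => j _.
by rewrite -tr_col sqnormT.
Qed.

Lemma sqnorm_row_le a b (M : 'M[R]_(a, b)) i : sqnorm (row i M) <= sqnorm M.
Proof.
by rewrite (sqnorm_rows M) (bigD1 i) //= lerDl sumr_ge0 // => j _; exact: sqnorm_ge0.
Qed.

Lemma fnorm_row_le a b (M : 'M[R]_(a, b)) i : fnorm (row i M) <= fnorm M.
Proof. by rewrite fnorm_le_fnorm sqnorm_row_le. Qed.

Lemma sqnormM a b c (M : 'M[R]_(a, b)) (N : 'M[R]_(b, c)) :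
  sqnorm (M *m N) <= sqnorm M * sqnorm N.
Proof.
rewrite (sqnormE (M *m N)) (sqnorm_rows M) (sqnorm_cols N) mulr_suml.
apply: ler_sum => i _; rewrite mulr_sumr; apply: ler_sum => j _.
have -> : (M *m N) i j = fdot (row i M) (col j N)^T.
  by rewrite /fdot big_ord1 mxE; apply: eq_bigr => k _; rewrite !mxE.
by apply: le_trans (fdot_cauchy_schwarz _ _) _; rewrite sqnormT.
Qed.

Lemma fnormM a b c (M : 'M[R]_(a, b)) (N : 'M[R]_(b, c)) :
  fnorm (M *m N) <= fnorm M * fnorm N.
Proof.
by rewrite fnorm_le ?mulr_ge0 ?fnorm_ge0 // exprMn !fnorm_sq sqnormM.
Qed.

Definition orthonormal_cols a b (V : 'M[R]_(a, b)) : Prop := V^T *m V = 1%:M.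

Lemma orthonormal_colsT a (V : 'M[R]_a) : orthonormal_cols V -> orthonormal_cols V^T.
Proof. by move=> VV; rewrite /orthonormal_cols trmxK (mulmx1C VV). Qed.

Lemma orthonormal_cols_mul a b c (V : 'M[R]_(a, b)) (W : 'M[R]_(b, c)) :
  orthonormal_cols V -> orthonormal_cols W -> orthonormal_cols (V *m W).
Proof.
by rewrite /orthonormal_cols => VV WW; rewrite trmx_mul mulmxA -(mulmxA W^T) VV mulmx1.
Qed.

Lemma sqnorm_orthonormal_cols a b (V : 'M[R]_(a, b)) :
  orthonormal_cols V -> sqnorm V = b%:R.
Proof. by move=> VV; rewrite -sqnormT sqnorm_trace trmxK VV mxtrace1. Qed.

Lemma fdot_isometry a b c (V : 'M[R]_(a, b)) (M N : 'M[R]_(b, c)) :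
  orthonormal_cols V -> fdot (V *m M) (V *m N) = fdot M N.
Proof. by move=> VV; rewrite fdot_mull mulmxA VV mul1mx. Qed.

Lemma sqnorm_isometry a b c (V : 'M[R]_(a, b)) (M : 'M[R]_(b, c)) :
  orthonormal_cols V -> sqnorm (V *m M) = sqnorm M.
Proof. exact: fdot_isometry. Qed.

Lemma sqnorm_mul_trmx_isometry a b c (V : 'M[R]_(a, b)) (M : 'M[R]_(c, b)) :
  orthonormal_cols V -> sqnorm (M *m V^T) = sqnorm M.
Proof. by move=> VV; rewrite -sqnormT trmx_mul trmxK sqnorm_isometry // sqnormT. Qed.

Definition orthoproj a (P : 'M[R]_a) : Prop := P^T = P /\ P *m P = P.

Lemma orthoproj_gram a b (V : 'M[R]_(a, b)) : orthonormal_cols V -> orthoproj (V *m V^T).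
Proof. by move=> VV; split; rewrite ?trmx_mul ?trmxK // mulmxA -(mulmxA V) VV mulmx1. Qed.

Lemma orthoproj_compl a (P : 'M[R]_a) : orthoproj P -> orthoproj (1%:M - P).
Proof.
move=> [PT PP]; split; first by rewrite linearB /= tr_scalar_mx PT.
by rewrite mulmxBl mul1mx mulmxBr mulmx1 PP subrr subr0.
Qed.

Lemma orthoproj_delta a (i : 'I_a) : orthoproj (delta_mx i i).
Proof. by split; rewrite ?trmx_delta ?mul_delta_mx. Qed.

Lemma sqnorm_orthoproj_mul a b (P : 'M[R]_a) (M : 'M[R]_(a, b)) :
  orthoproj P -> sqnorm (P *m M) <= sqnorm M.
Proof.
move=> [PT PP]; have := sqnorm_ge0 (M - P *m M); rewrite sqnormB.
suff -> : fdot M (P *m M) = sqnorm (P *m M) by lra.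
by rewrite /sqnorm fdot_mull PT mulmxA PP.
Qed.

Lemma sqnorm_mul_orthoproj a b (P : 'M[R]_b) (M : 'M[R]_(a, b)) :
  orthoproj P -> sqnorm (M *m P) <= sqnorm M.
Proof.
move=> Pproj; rewrite -sqnormT trmx_mul -(sqnormT M) (proj1 Pproj).
exact: sqnorm_orthoproj_mul.
Qed.

Definition opnorm_le a b (E : 'M[R]_(a, b)) (t : R) : Prop :=
  forall x : 'cV[R]_b, sqnorm (E *m x) <= t ^+ 2 * sqnorm x.

Lemma sqnorm_opnorm_le a b c (E : 'M[R]_(a, b)) t (M : 'M[R]_(b, c)) :
  opnorm_le E t -> sqnorm (E *m M) <= t ^+ 2 * sqnorm M.
Proof.
move=> Et; rewrite (sqnorm_cols M) sqnorm_cols mulr_sumr; apply: ler_sum => j _.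
by rewrite !colE -mulmxA Et.
Qed.

Lemma fnorm_opnorm_le a b c (E : 'M[R]_(a, b)) t (M : 'M[R]_(b, c)) :
  0 <= t -> opnorm_le E t -> fnorm (E *m M) <= t * fnorm M.
Proof.
move=> t0 Et; rewrite fnorm_le ?mulr_ge0 ?fnorm_ge0 // exprMn fnorm_sq.
exact: sqnorm_opnorm_le.
Qed.

Lemma sqnorm_mul_diag_le a b (M : 'M[R]_(a, b)) (s : 'rV[R]_b) S :
  (forall j, s 0 j ^+ 2 <= S) -> sqnorm (M *m diag_mx s) <= S * sqnorm M.
Proof.
move=> s_le; rewrite mul_mx_diag !sqnormE mulr_sumr; apply: ler_sum => i _.
rewrite mulr_sumr; apply: ler_sum => j _; rewrite mxE exprMn mulrC.
by apply: ler_wpM2r; [exact: sqr_ge0|exact: s_le].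
Qed.

Definition quadform a (E : 'M[R]_a) (x : 'rV[R]_a) : R := fdot (E *m x^T) x^T.

Lemma quadformD a (E F : 'M[R]_a) (x : 'rV[R]_a) :
  quadform (E + F) x = quadform E x + quadform F x.
Proof. by rewrite /quadform mulmxDl fdotDl. Qed.

Lemma quadform0r a (E : 'M[R]_a) : quadform E 0 = 0.
Proof. by rewrite /quadform trmx0 fdot0r. Qed.

Lemma quadform_diag a (d x : 'rV[R]_a) : quadform (diag_mx d) x = \sum_i d 0 i * x 0 i ^+ 2.
Proof.
rewrite /quadform /fdot; apply: eq_bigr => i _.
by rewrite big_ord1 mul_diag_mx !mxE; ring.
Qed.

Lemma quadform_conj a b (V : 'M[R]_(a, b)) (E : 'M[R]_b) (x : 'rV[R]_a) :
  quadform (V *m E *m V^T) x = quadform E (x *m V).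
Proof. by rewrite /quadform trmx_mul -!mulmxA fdot_mull. Qed.

Lemma quadform_opnorm_le a (E : 'M[R]_a) t (x : 'rV[R]_a) : 0 <= t -> opnorm_le E t ->
  `|quadform E x| <= t * sqnorm x.
Proof.
move=> t0 Et; have CS (y : 'cV[R]_a) : fnorm y = fnorm x ->
    fdot (E *m x^T) y <= t * sqnorm x.
  move=> yx; apply: le_trans (fdot_le_fnorm _ _) _.
  rewrite yx -fnorm_sq expr2 mulrA; apply: ler_wpM2r; first exact: fnorm_ge0.
  by rewrite -[in leRHS]fnormT; exact: fnorm_opnorm_le.
by rewrite ler_norml lerNl -fdotNr; apply/andP; split; apply: CS; rewrite ?fnormN fnormT.
Qed.

End FrobeniusNorm.

Section SpectralTheorem.
Variable R : rcfType.

Lemma symmetric_eigenvalue n (A : 'M[R]_n.+1) : A^T = A -> exists x, eigenvalue A x.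
Proof.
move=> Asym; pose f : {rmorphism R -> complex R} := real_complex R.
pose B := map_mx f A; pose P := spectralmx B; pose d := spectral_diag B.
have Bherm : B \is hermsymmx.
  apply: realsym_hermsym; last by apply/mxOverP => i j; rewrite mxE complex_real.
  by apply/is_hermitianmxP/matrixP => i j; rewrite expr0 scale1r !mxE -{1}Asym mxE.
have PB : P *m B = diag_mx d *m P.
  have /hermitian_normalmx/orthomx_spectralP {1}-> := Bherm.
  by rewrite !mulmxA mulmxV ?spectral_unit ?mul1mx.
have d_real : d 0 0 \is Num.real by apply/mxOverP; exact: hermitian_spectral_diag_real.
have xE : f (complex.Re (d 0 0)) = d 0 0 by exact: RRe_real d_real.
exists (complex.Re (d 0 0)); rewrite -(eigenvalue_map f); apply/eigenvalueP.
exists (row 0 P).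
  by rewrite -row_mul PB row_mul row_diag_mx -scalemxAl -rowE xE.
apply/eqP => P0; have /(congr1 (row 0)) := mulmxV (spectral_unit B).
by rewrite row_mul P0 mul0mx row1 => /rowP/(_ 0)/eqP; rewrite !mxE eqxx eq_sym oner_eq0.
Qed.

Lemma symmetric_unit_eigenvector n (A : 'M[R]_n.+1) : A^T = A ->
  exists (x : R) (u : 'cV[R]_n.+1), sqnorm u = 1 /\ A *m u = x *: u.
Proof.
move=> Asym; have [x /eigenvalueP[v vA /sqnorm_gt0 v_gt0]] := symmetric_eigenvalue Asym.
exists x, ((fnorm v)^-1 *: v^T); split.
  by rewrite sqnormZ sqnormT exprVn fnorm_sq mulVf ?gt_eqF.
by rewrite -scalemxAr -{1}Asym -trmx_mul vA linearZ /= !scalerA mulrC.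
Qed.

(* The Householder reflection exchanging [u] and the first basis vector. *)
Lemma symmetric_orthogonal_first_col n (u : 'cV[R]_n.+1) : sqnorm u = 1 ->
  exists H : 'M[R]_n.+1, [/\ H^T = H, H *m H = 1%:M & col 0 H = u].
Proof.
move=> u1; pose e : 'cV[R]_n.+1 := delta_mx 0 0.
have e1 : sqnorm e = 1.
  by rewrite -sqnormT sqnorm_trace trmxK trmx_delta mul_delta_mx trace_mx11 mxE.
have [ue|ue] := eqVneq u e.
  by exists 1%:M; rewrite tr_scalar_mx mulmx1 colE mul1mx ue.
pose v := e - u.
have v0 : sqnorm v != 0 by rewrite gt_eqF ?sqnorm_gt0 // subr_eq0 eq_sym.
have fdot11 (x y : 'cV[R]_n.+1) : x^T *m y = (fdot x y)%:M.
  by rewrite [LHS]mx11_scalar fdotC fdot_trace mxtrace_mulC trace_mx11.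
have ve : fdot v e = sqnorm v / 2.
  by rewrite /v sqnormB fdotDl fdotNl e1 u1 -[fdot e e]/(sqnorm e) e1 fdotC; lra.
pose H := 1%:M - (2 / sqnorm v) *: (v *m v^T); exists H; split.
- by rewrite /H linearB /= tr_scalar_mx linearZ /= trmx_mul trmxK.
- rewrite /H mulmxBl mul1mx mulmxBr mulmx1 -scalemxAl -scalemxAr scalerA.
  rewrite -mulmxA (mulmxA v^T) fdot11 mul_scalar_mx -scalemxAr scalerA.
  rewrite -[fdot v v]/(sqnorm v) (_ : _ / _ * _ * _ = 2 / sqnorm v + 2 / sqnorm v); last by field.
  by rewrite scalerDl opprB addrK subrK.
- rewrite colE /H mulmxBl mul1mx -scalemxAl -mulmxA fdot11 ve mul_mx_scalar scalerA.
  by rewrite (_ : _ * _ = 1) ?scale1r ?subKr //; field.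
Qed.

Lemma symmetric_deflation n (A : 'M[R]_(1 + n)) : A^T = A ->
  exists (H : 'M[R]_(1 + n)) (x : R) (B : 'M[R]_n),
    [/\ orthonormal_cols H, B^T = B & H^T *m A *m H = block_mx x%:M 0 0 B].
Proof.
move=> Asym; have [x [u [u1 Au]]] := symmetric_unit_eigenvector Asym.
have [H [HT HH Hu]] := symmetric_orthogonal_first_col u1.
have [C CE] : exists C : 'M[R]_(1 + n), C = H *m A *m H by exists (H *m A *m H).
have CT : C^T = C by rewrite CE !trmx_mul HT Asym mulmxA.
have C0 : col 0 C = x *: delta_mx 0 0.
  by rewrite colE CE -!mulmxA -colE Hu Au -scalemxAr -Hu colE (mulmxA H H) HH mul1mx.
have Ccol i : C i 0 = x * (i == 0)%:R.
  by have := congr1 (fun M : 'cV_n.+1 => M i 0) C0; rewrite !mxE eqxx andbT.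
have l0 (i : 'I_1) : lshift n i = 0 by apply: val_inj; rewrite /= ord1.
exists H, x, (drsubmx C); split; [by rewrite /orthonormal_cols HT|by rewrite trmx_drsub CT|].
rewrite HT -CE -{1}(submxK C); congr block_mx; apply/matrixP => i j.
- by rewrite !mxE !l0 Ccol !ord1 !eqxx mulr1 mulr1n.
- by rewrite -CT !mxE l0 Ccol mulr0.
- by rewrite !mxE l0 Ccol mulr0.
Qed.

Definition eigenbasis n (A V : 'M[R]_n) (l : 'rV[R]_n) : Prop :=
  orthonormal_cols V /\ V^T *m A *m V = diag_mx l.

Lemma symmetric_eigenbasis n (A : 'M[R]_n) : A^T = A -> exists V l, eigenbasis A V l.
Proof.
elim: n A => [|n IH] A Asym; first by exists 1%:M, 0; split; apply/matrixP => -[].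
have [H [x [B [HH Bsym HAH]]]] := @symmetric_deflation n A Asym.
have [P [l [PP PBP]]] := IH B Bsym.
pose W : 'M[R]_(1 + n) := block_mx 1%:M 0 0 P.
have WT : W^T = block_mx 1%:M 0 0 P^T by rewrite /W tr_block_mx !trmx0 tr_scalar_mx.
have WW : orthonormal_cols W.
  rewrite /orthonormal_cols WT /W mulmx_block.
  by rewrite !(mul0mx, mulmx0, mulmx1, mul1mx, addr0, add0r) PP -scalar_mx_block.
have WBW : W^T *m block_mx x%:M 0 0 B *m W = diag_mx (row_mx x%:M l).
  rewrite WT /W !mulmx_block.
  rewrite !(mul0mx, mulmx0, mulmx1, mul1mx, addr0, add0r) PBP diag_mx_row.
  by congr block_mx; apply/matrixP => i j; rewrite !mxE !ord1.
exists (H *m W), (row_mx x%:M l); split; first exact: orthonormal_cols_mul.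
by rewrite -WBW -HAH trmx_mul !mulmxA.
Qed.

Lemma eigenbasis_decomp n (A V : 'M[R]_n) l : eigenbasis A V l -> A = V *m diag_mx l *m V^T.
Proof.
move=> [VV VAV]; have VVt := mulmx1C VV.
by rewrite -VAV !mulmxA VVt mul1mx -mulmxA VVt mulmx1.
Qed.

Definition sorted_eigenbasis n (A V : 'M[R]_n) (l : 'rV[R]_n) : Prop :=
  eigenbasis A V l /\ forall i j : 'I_n, (i <= j)%N -> l 0 j <= l 0 i.

Lemma eigenbasis_col_perm n (A V : 'M[R]_n) l (s : 'S_n) :
  eigenbasis A V l -> eigenbasis A (col_perm s V) (col_perm s l).
Proof.
rewrite /eigenbasis /orthonormal_cols tr_col_perm row_permEsub !col_permEsub.
rewrite !mul_rowsub_mx !mulmx_colsub => -[-> ->].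
by split; apply/matrixP => i j; rewrite !mxE (inj_eq perm_inj).
Qed.

Lemma symmetric_sorted_eigenbasis n (A : 'M[R]_n) : A^T = A ->
  exists V l, sorted_eigenbasis A V l.
Proof.
move=> /symmetric_eigenbasis[V [l Vl]].
pose geR : rel R := fun x y => y <= x.
pose t := [tuple l 0 i | i < n].
have tsort : perm_eq (sort_tuple geR t) t by rewrite perm_sort.
have [s sE] := tuple_permP tsort.
have ls i : l 0 (s i) = nth 0 (sort geR t) i.
  by rewrite -[sort _ _]/(tval (sort_tuple geR t)) sE -tnth_nth !tnth_mktuple.
exists (col_perm s V), (col_perm s l); split; first exact: eigenbasis_col_perm.
move=> i j ij; rewrite !mxE !ls.
have geR_trans : transitive geR by move=> x y z xy yz; exact: le_trans yz xy.
have geR_total : total geR by move=> x y; exact: le_total.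
apply: (sorted_leq_nth geR_trans _ 0 (sort_sorted geR_total t)) ij => //.
  by move=> x; exact: lexx.
all: by rewrite inE size_sort size_tuple.
Qed.

End SpectralTheorem.

Section ExponentialBounds.
Variable R : realType.

Lemma expR_le1D2x (x : R) : 0 <= x <= 1 / 2 -> expR x <= 1 + 2 * x.
Proof.
move=> /andP[x0 x_half]; have := expR_ge1Dx (- x); rewrite expRN => e_lower.
have ex_gt0 := expR_gt0 x.
have : (1 - x) * expR x <= 1.
  by rewrite -[leRHS](mulVf (lt0r_neq0 ex_gt0)) ler_pM2r.
by nra.
Qed.

Lemma expr_le_expR (y c : R) s :
  0 <= y -> 0 < c -> y ^+ s <= c ^+ s * expR (s%:R * (y / c)).
Proof.
move=> y0 c0; rewrite expRM_natl -exprMn lerXn2r // ?nnegrE //.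
  by rewrite mulr_ge0 ?expR_ge0 // ltW.
by rewrite mulrC -ler_pdivrMr //; apply: le_trans (expR_ge1Dx _); rewrite lerDr.
Qed.

End ExponentialBounds.

Section BernoulliExpectation.
Variables (R : realType) (I : finType).
Local Notation sample := {ffun I -> bool}.
Implicit Types (F G : sample -> R) (P Q : sample -> Prop) (w : sample).

Definition expect (p : R) F : R := \sum_w bern p w * F w.

Definition prob (p : R) P : R := expect p (fun w => if `[< P w >] then 1 else 0).

Definition centered (p : R) w : I -> R := fun i => (w i)%:R / p - 1.

Definition increment (p : R) w w' : I -> R := fun i => ((w i)%:R - (w' i)%:R) / p.

Definition splice (S : pred I) w w' : sample := [ffun x => if S x then w x else w' x].

Lemma expect_prod p (g : I -> bool -> R) :
  expect p (fun w => \prod_x g x (w x)) =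
  \prod_x (p * g x true + (1 - p) * g x false).
Proof.
transitivity (\sum_(w : sample) \prod_x ((if w x then p else 1 - p) * g x (w x))).
  by apply: eq_bigr => w _; rewrite big_split.
rewrite -(bigA_distr_bigA (fun x b => (if b then p else 1 - p) * g x b)).
by apply: eq_bigr => x _; rewrite big_bool.
Qed.

Lemma expectD p F G : expect p (fun w => F w + G w) = expect p F + expect p G.
Proof. by rewrite -big_split /=; apply: eq_bigr => w _; rewrite mulrDr. Qed.

Lemma expectZ p c F : expect p (fun w => c * F w) = c * expect p F.
Proof. by rewrite mulr_sumr; apply: eq_bigr => w _; rewrite mulrCA. Qed.

Lemma expectMr p c F : expect p (fun w => F w * c) = expect p F * c.
Proof. by rewrite mulr_suml; apply: eq_bigr => w _; rewrite mulrA. Qed.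

Lemma eq_expect p F G : F =1 G -> expect p F = expect p G.
Proof. by move=> FG; apply: eq_bigr => w _; rewrite FG. Qed.

Lemma expect_cst p c : expect p (fun=> c) = c.
Proof.
have total : expect p (fun=> 1) = 1.
  transitivity (expect p (fun=> \prod_(x : I) 1)); first by apply: eq_expect => w; rewrite big1.
  by rewrite (expect_prod p (fun _ _ => 1)) big1 // => x _; ring.
by rewrite -[in RHS](mulr1 c) -total -expectZ; apply: eq_expect => w; rewrite mulr1.
Qed.

Lemma expect_sum p (J : finType) (F : J -> sample -> R) :
  expect p (fun w => \sum_j F j w) = \sum_j expect p (F j).
Proof. by rewrite exchange_big; apply: eq_bigr => w _; rewrite mulr_sumr. Qed.

Lemma expect_coord p x : expect p (fun w => (w x)%:R) = p.
Proof.
transitivity (expect p (fun w => \prod_y (if y == x then (w y)%:R else 1))).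
  by apply: eq_expect => w; rewrite -big_mkcond /= big_pred1_eq.
rewrite (expect_prod p (fun y b => if y == x then b%:R else 1)) (bigD1 x) //= eqxx.
rewrite big1 => [|y /negPf->]; first by rewrite !mulr1 mulr0 addr0.
by rewrite !mulr1; ring.
Qed.

Lemma expect_centered p x : p != 0 -> expect p (fun w => centered p w x) = 0.
Proof. by move=> p0; rewrite expectD expectMr expect_coord expect_cst divff ?subrr. Qed.

Lemma expect_exchange p (F : sample -> sample -> R) :
  expect p (fun w => expect p (F w)) = expect p (fun w' => expect p (F^~ w')).
Proof.
rewrite /expect; under eq_bigr do rewrite mulr_sumr.
rewrite exchange_big /=; apply: eq_bigr => w' _.
by rewrite mulr_sumr; apply: eq_bigr => w _; rewrite mulrCA.
Qed.

Lemma expect_splice_swap p (S : pred I) (F : sample -> sample -> R) :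
  expect p (fun w => expect p (fun w' => F w w')) =
  expect p (fun w => expect p (fun w' => F (splice S w w') (splice S w' w))).
Proof.
have pairE (G : sample -> sample -> R) : expect p (fun w => expect p (fun w' => G w w')) =
    \sum_(u : sample * sample) bern p u.1 * bern p u.2 * G u.1 u.2.
  rewrite -(pair_bigA _ (fun w w' => bern p w * bern p w' * G w w')) /=.
  by apply: eq_bigr => w _; rewrite mulr_sumr; apply: eq_bigr => w' _; rewrite mulrA.
rewrite !pairE.
pose exchange (u : sample * sample) := (splice S u.1 u.2, splice S u.2 u.1).
have exchangeK : involutive exchange.
  by case=> w w'; congr pair; apply/ffunP => x; rewrite !ffunE; case: (S x).
rewrite (reindex_inj (inv_inj exchangeK)); apply: eq_bigr => -[w w'] _ /=; congr (_ * _).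
rewrite /bern -!big_split /=; apply: eq_bigr => x _; rewrite !ffunE.
by case: (S x) => //; rewrite mulrC.
Qed.

Lemma expect_resample p (S : pred I) F :
  expect p F = expect p (fun w' => expect p (fun w => F (splice S w w'))).
Proof.
rewrite -expect_exchange -(expect_splice_swap p S (fun w _ => F w)).
by apply: eq_expect => w; rewrite expect_cst.
Qed.

Lemma prob_compl p P : prob p (fun w => ~ P w) = 1 - prob p P.
Proof.
suff : prob p (fun w => ~ P w) + prob p P = 1 by lra.
rewrite /prob -expectD -[RHS](expect_cst p); apply: eq_expect => w.
by rewrite asbool_neg; case: asboolP => _ /=; ring.
Qed.

Lemma prob_never p P : (forall w, ~ P w) -> prob p P = 0.
Proof.
by move=> NP; rewrite -[RHS](expect_cst p); apply: eq_expect => w; rewrite asboolF.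
Qed.

Lemma prob_always p P : (forall w, P w) -> prob p P = 1.
Proof.
by move=> allP; rewrite -[RHS](expect_cst p); apply: eq_expect => w; rewrite asboolT.
Qed.

Section Monotone.
Variable p : R.
Hypothesis p01 : 0 <= p <= 1.

Lemma bern_ge0 w : 0 <= bern p w.
Proof. by case/andP: p01 => p0 p1; apply: prodr_ge0 => x _; case: ifP => _; lra. Qed.

Lemma expect_le F G : (forall w, F w <= G w) -> expect p F <= expect p G.
Proof. by move=> FG; apply: ler_sum => w _; apply: ler_wpM2l; [exact: bern_ge0|]. Qed.

Lemma expect_ge0 F : (forall w, 0 <= F w) -> 0 <= expect p F.
Proof. by move=> F0; rewrite -(expect_cst p 0); exact: expect_le. Qed.

Lemma prob_ge0 P : 0 <= prob p P.
Proof. by apply: expect_ge0 => w; case: ifP. Qed.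

Lemma prob_le P Q : (forall w, P w -> Q w) -> prob p P <= prob p Q.
Proof.
move=> PQ; apply: expect_le => w; case: asboolP => [/PQ Qw|_].
  by rewrite asboolT.
by case: ifP => _; rewrite ?ler01.
Qed.

Lemma prob_markov F t c : 0 < t -> (forall w, 0 <= F w) -> expect p F <= t * c ->
  prob p (fun w => t < F w) <= c.
Proof.
move=> t0 F0 EF_le; rewrite -(ler_pM2l t0); apply: le_trans EF_le.
rewrite -expectZ; apply: expect_le => w.
by case: asboolP => [/ltW|_]; rewrite ?mulr1 ?mulr0.
Qed.

Lemma prob_exists (J : finType) (P : J -> sample -> Prop) c :
  (forall j, prob p (P j) <= c) -> prob p (fun w => exists j, P j w) <= #|J|%:R * c.
Proof.
move=> Pc; apply: (@le_trans _ _ (\sum_j prob p (P j))); last first.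
  by apply: (le_trans (ler_sum _ (fun j _ => Pc j))); rewrite sumr_const mulr_natl.
rewrite /prob -expect_sum; apply: expect_le => w.
have indic_ge0 j : 0 <= (if `[< P j w >] then 1 else 0) :> R by case: ifP.
case: asboolP => [[j Pj]|_]; last exact: sumr_ge0.
by rewrite (bigD1 j) //= (asboolT Pj) lerDl sumr_ge0.
Qed.

Lemma prob_or P Q : prob p (fun w => P w \/ Q w) <= prob p P + prob p Q.
Proof.
rewrite /prob -expectD; apply: expect_le => w.
have indic_ge0 P' : 0 <= (if `[< P' w >] then 1 else 0) :> R by case: ifP.
case: asboolP => [[Pw|Qw]|_]; last exact: addr_ge0.
  by rewrite (asboolT Pw) lerDl.
by rewrite (asboolT Qw) lerDr.
Qed.

Lemma prob_moment_tail F (u c : R) s : 0 < u -> (forall w, 0 <= F w) ->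
  expect p F <= c * (expR 2 * u) ^+ s ->
  prob p (fun w => (expR 3 * u) ^+ s < F w) <= c * expR (- s%:R).
Proof.
move=> u0 F0 moment; apply: prob_markov => //.
  by rewrite exprn_gt0 // mulr_gt0 ?expR_gt0.
apply: le_trans moment _; rewrite mulrCA.
have -> : expR (- s%:R) = expR (-1) ^+ s :> R by rewrite -expRM_natl mulrN1.
by rewrite -exprMn mulrAC -expRD (_ : 3 + -1 = 2) //; ring.
Qed.

Lemma expect_expR_sum_le (b : I -> R) : (forall x, 0 <= b x <= 1 / 2) ->
  expect p (fun w => expR (\sum_x b x * (w x)%:R)) <= expR (2 * (p * \sum_x b x)).
Proof.
move=> b01; case/andP: (p01) => p0 p1.
under eq_expect do rewrite expR_sum.
rewrite (expect_prod p (fun x c => expR (b x * c%:R))).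
rewrite mulrA mulr_sumr expR_sum; apply: ler_prod => x _.
rewrite mulr1 mulr0 expR0 mulr1; have e_gt0 := expR_gt0 (b x); apply/andP; split.
  by apply: addr_ge0; [apply: mulr_ge0 => //; exact: ltW | lra].
apply: le_trans (expR_ge1Dx _).
by have := expR_le1D2x (b01 x) => e_upper; nra.
Qed.

Definition paired_sum (b : I -> R) w w' : R := \sum_x b x * ((w x)%:R + (w' x)%:R).

Lemma paired_sum_ge0 b w w' : (forall x, 0 <= b x) -> 0 <= paired_sum b w w'.
Proof. by move=> b0; apply: sumr_ge0 => x _; rewrite mulr_ge0 // addr_ge0. Qed.

Lemma paired_sum_moment_le (b : I -> R) (v : R) s : 0 < v ->
  (forall x, 0 <= b x) -> (forall x, s%:R * b x <= v) -> p * (\sum_x b x) <= v ->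
  expect p (fun w => expect p (fun w' => paired_sum b w w' ^+ s)) <= (2 * expR 2 * v) ^+ s.
Proof.
move=> v0 b0 b_max b_sum; have v2_gt0 : 0 < 2 * v by lra.
pose t := s%:R / (2 * v); pose G w := expR (\sum_x t * b x * (w x)%:R).
have tb_small x : 0 <= t * b x <= 1 / 2.
  rewrite mulr_ge0 ?divr_ge0 ?(ltW v2_gt0) //= /t mulrAC ler_pdivrMr //.
  by have := b_max x; lra.
have pow_le w w' : paired_sum b w w' ^+ s <= (2 * v) ^+ s * (G w * G w').
  apply: le_trans (expr_le_expR s (paired_sum_ge0 _ _ b0) v2_gt0) _.
  rewrite /G -expRD -big_split /= /paired_sum mulr_suml mulr_sumr.
  rewrite (eq_bigr (fun x => t * b x * (w x)%:R + t * b x * (w' x)%:R)) // => x _.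
  by rewrite /t; ring.
have EG_le : expect p G <= expR s%:R.
  apply: le_trans (expect_expR_sum_le tb_small) _; rewrite ler_expR -mulr_sumr.
  have -> : 2 * (p * (t * \sum_x b x)) = s%:R * (p * (\sum_x b x) / v).
    by rewrite /t; field; exact: lt0r_neq0.
  by rewrite -[leRHS]mulr1 ler_wpM2l // ler_pdivrMr // mul1r.
apply: le_trans (_ : (2 * v) ^+ s * (expect p G * expect p G) <= _).
  rewrite -expectMr -expectZ; apply: expect_le => w.
  by rewrite -!expectZ; apply: expect_le => w'; exact: pow_le.
have -> : 2 * expR 2 * v = 2 * v * (expR 1 * expR 1).
  by rewrite -expRD mulrAC; congr (_ * expR _); ring.
rewrite [leRHS]exprMn [(expR 1 * _) ^+ s]exprMn -expRM_natl mulr1.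
apply: ler_wpM2l; first by nonneg.
by apply: ler_pM => //; apply: expect_ge0 => w; exact: expR_ge0.
Qed.

Lemma sum_sq_increment_le (b : I -> R) w w' : (forall x, 0 <= b x) ->
  \sum_x increment p w w' x ^+ 2 * b x <=
  paired_sum (fun x => b x / p ^+ 2) w w'.
Proof.
move=> b0; apply: ler_sum => x _; rewrite /increment expr_div_n mulrAC -mulrA mulrC.
apply: ler_wpM2l; first by rewrite divr_ge0 ?sqr_ge0.
by case: (w x); case: (w' x); rewrite /= ?expr2; lra.
Qed.

(* [b x] is the squared size of the coefficient of [w x]: the first bound is on a variance,
   the second one on the largest jump. *)
Definition variance_proxy s (b : I -> R) (v : R) : Prop :=
  (\sum_x b x) / p <= v /\ forall x, s%:R * (b x / p ^+ 2) <= v.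

Lemma variance_proxy_scale s b b' v c : 0 < p -> 0 <= c -> (forall x, b' x <= b x * c) ->
  variance_proxy s b v -> variance_proxy s b' (v * c).
Proof.
move=> p0 c0 b'_le [b_sum b_max]; split => [|x].
  apply: le_trans (ler_wpM2r c0 b_sum); rewrite mulrAC ler_pM2r ?invr_gt0 //.
  by rewrite mulr_suml; apply: ler_sum.
apply: le_trans (ler_wpM2r c0 (b_max x)); rewrite -mulrA; apply: ler_wpM2l => //.
by rewrite mulrAC ler_pM2r ?invr_gt0 ?exprn_gt0.
Qed.

Lemma paired_sum_proxy_moment_le s (b : I -> R) (v : R) : 0 < p -> 0 < v ->
  (forall x, 0 <= b x) -> variance_proxy s b v ->
  expect p (fun w => expect p (fun w' =>
    ((2 * s)%:R * paired_sum (fun x => b x / p ^+ 2) w w') ^+ s)) <=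
  (expR 2 * (4 * s%:R * v)) ^+ s.
Proof.
move=> p0 v0 b0 [b_sum b_max].
under eq_expect do (under eq_expect do rewrite exprMn); under eq_expect do rewrite expectZ.
have -> : expR 2 * (4 * s%:R * v) = (2 * s)%:R * (2 * expR 2 * v) by rewrite natrM; ring.
rewrite expectZ exprMn; apply: ler_wpM2l; first by rewrite exprn_ge0.
apply: paired_sum_moment_le => // [x|]; first by rewrite divr_ge0 ?sqr_ge0.
rewrite -mulr_suml (_ : p * _ = (\sum_x b x) / p) //; field; exact: lt0r_neq0.
Qed.

End Monotone.
End BernoulliExpectation.

Section TailLevel.
Variable R : realType.

Definition tail_level s (v : R) : R := expR 3 * (4 * s%:R * v).

Lemma tail_level_ge0 s v : 0 <= v -> 0 <= tail_level s v.
Proof. by move=> v0; rewrite mulr_ge0 ?expR_ge0 // mulr_ge0. Qed.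

Lemma tail_levelM s v c : tail_level s (v * c) = tail_level s v * c.
Proof. by rewrite /tail_level !mulrA. Qed.

End TailLevel.

Section ProductBernoulli.
Variables (R : realType) (X Y : finType).

Lemma prob2_expect (p q : R) (E : {ffun X -> bool} -> {ffun Y -> bool} -> Prop) :
  prob2 p q E = expect p (fun w => prob q (E w)).
Proof.
by apply: eq_bigr => w _; rewrite mulr_sumr; apply: eq_bigr => e _; rewrite mulrA.
Qed.

Lemma prob2_always (p q : R) (E : {ffun X -> bool} -> {ffun Y -> bool} -> Prop) :
  (forall w e, E w e) -> prob2 p q E = 1.
Proof.
move=> allE; rewrite prob2_expect -[RHS](expect_cst X p).
by apply: eq_expect => w; rewrite prob_always.
Qed.

Lemma prob2_ge (p q d d' : R) (good : {ffun X -> bool} -> Prop)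
    (E : {ffun X -> bool} -> {ffun Y -> bool} -> Prop) :
  0 <= p <= 1 -> 0 <= q <= 1 -> 0 <= d -> prob p (fun w => ~ good w) <= d' ->
  (forall w, good w -> prob q (fun e => ~ E w e) <= d) -> 1 - (d + d') <= prob2 p q E.
Proof.
move=> p01 q01 d0 bad_le failure_le; rewrite prob2_expect.
suff : 1 - d <= expect p (fun w => prob q (E w)) + prob p (fun w => ~ good w) by lra.
rewrite -[leLHS](expect_cst X p) -expectD; apply: expect_le => // w.
case: asboolP => [_|/contrapT/failure_le]; first by have := prob_ge0 q01 (E w); lra.
by rewrite prob_compl; lra.
Qed.

End ProductBernoulli.

Section PowerInequalities.
Variable R : realFieldType.
Implicit Types x y t u : R.

Lemma exprS_tangent_le t u s : 0 <= t -> 0 <= u ->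
  u ^+ s.+1 + s.+1%:R * u ^+ s * (t - u) <= t ^+ s.+1.
Proof.
move=> t0 u0; elim: s => [|s IH]; first by rewrite !expr1 expr0; lra.
rewrite [leRHS]exprS; apply: le_trans (ler_wpM2l t0 IH).
have : 0 <= s.+1%:R * u ^+ s * (t - u) ^+ 2 by nonneg.
by rewrite !exprS -!natr1; lra.
Qed.

Lemma expr_even_tangent_le x y s :
  x ^+ (2 * s.+1) + (2 * s.+1)%:R * x ^+ (2 * s).+1 * (y - x) <= y ^+ (2 * s.+1).
Proof.
rewrite !exprM; apply: le_trans (exprS_tangent_le s (sqr_ge0 y) (sqr_ge0 x)).
have : 0 <= s.+1%:R * (x ^+ 2) ^+ s * (y - x) ^+ 2 by nonneg.
by rewrite [x ^+ (2 * s).+1]exprS exprM natrM; lra.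
Qed.

Lemma expr_odd_mono x y s : 0 <= (x - y) * (x ^+ (2 * s).+1 - y ^+ (2 * s).+1).
Proof.
elim: s x y => [|s IH] x y; first by rewrite -expr2 sqr_ge0.
have sym : 0 <= (x ^+ 2 + y ^+ 2) / 2 * ((x - y) * (x ^+ (2 * s).+1 - y ^+ (2 * s).+1)).
  by rewrite mulr_ge0 ?IH // divr_ge0 // addr_ge0 ?sqr_ge0.
have antisym : 0 <= (x - y) ^+ 2 / 2 * ((x - - y) * (x ^+ (2 * s).+1 - (- y) ^+ (2 * s).+1)).
  by rewrite mulr_ge0 ?IH // divr_ge0 // sqr_ge0.
move: sym antisym; have -> : (2 * s.+1)%N = (2 * s).+2 by lia.
by rewrite !exprS !exprM sqrrN; lra.
Qed.

(* The trapezoidal rule overestimates the integral of the convex function [(2s+1) t^(2s)]. *)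
Lemma expr_odd_trapezoid_le x y s :
  (x - y) * (x ^+ (2 * s).+1 - y ^+ (2 * s).+1) <=
  (2 * s).+1%:R / 2 * (x - y) ^+ 2 * (x ^+ (2 * s) + y ^+ (2 * s)).
Proof.
elim: s => [|s IH]; first by rewrite !muln0 !expr1 !expr0; lra.
set increment := _ * _ in IH; have incr_ge0 : 0 <= increment := expr_odd_mono x y s.
have quadratic : 0 <= (x - y) ^+ 2 / 2 * increment by nonneg.
have inductive : 0 <= (x ^+ 2 + y ^+ 2) / 2 *
    ((2 * s).+1%:R / 2 * (x - y) ^+ 2 * (x ^+ (2 * s) + y ^+ (2 * s)) - increment).
  by apply: mulr_ge0; [nonneg | rewrite subr_ge0].
have even_mono : 0 <= (x ^+ 2 - y ^+ 2) * (x ^+ (2 * s) - y ^+ (2 * s)).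
  rewrite !exprM [_ ^+ s - _]subrXX mulrA -expr2; apply: mulr_ge0; first exact: sqr_ge0.
  by apply: sumr_ge0 => i _; apply: mulr_ge0; apply: exprn_ge0; exact: sqr_ge0.
have rest : 0 <= (2 * s).+1%:R / 4 * (x - y) ^+ 2 *
    ((x ^+ 2 - y ^+ 2) * (x ^+ (2 * s) - y ^+ (2 * s))).
  by apply: mulr_ge0 even_mono; nonneg.
move: quadratic inductive rest; rewrite /increment.
have -> : (2 * s.+1)%N = (2 * s).+2 by lia.
rewrite !exprS -[(2 * s).+3]addn2 -[(2 * s).+1]addn1 !natrD.
by move: (x ^+ (2 * s)) (y ^+ (2 * s)) ((2 * s)%:R : R) => X Y k; lra.
Qed.

Lemma expr_bigmax_le_sum (J : finType) (g : J -> R) s : (0 < s)%N ->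
  (forall j, 0 <= g j) -> (\big[Num.max/0]_j g j) ^+ s <= \sum_j g j ^+ s.
Proof.
move=> s0 g0; suff [] : 0 <= \big[Num.max/0]_j g j /\
  (\big[Num.max/0]_j g j) ^+ s <= \sum_j g j ^+ s by [].
elim/big_ind2: _ => [|x X y Y [x0 xX] [y0 yY]|j _]; first by rewrite expr0n gtn_eqF.
  split; first by rewrite le_max x0.
  have X0 := le_trans (exprn_ge0 s x0) xX; have Y0 := le_trans (exprn_ge0 s y0) yY.
  by rewrite maxEle; case: ifP => _; lra.
by [].
Qed.

End PowerInequalities.

Section Symmetrization.
Variables (R : realType) (I : finType) (X : lmodType R) (H : I -> X).

Definition lincomb (c : I -> R) : X := \sum_i c i *: H i.

(* The two families of interest are [tr x^(2s)], with [polar s x y = tr (x^(2s+1) y)] and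
   [weight s x h = tr (x^(2s) h^2)], and their analogues on a Euclidean space. *)
Record even_moments (moment : nat -> X -> R) (polar weight : nat -> X -> X -> R) : Prop := {
  moment_ge0 : forall s c, 0 <= moment s (lincomb c);
  momentS : forall s c, moment s.+1 (lincomb c) = polar s (lincomb c) (lincomb c);
  polarD : forall s x y z, polar s x (y + z) = polar s x y + polar s x z;
  polarZ : forall s x a y, polar s x (a *: y) = a * polar s x y;
  weightZ : forall s x a y, weight s x (a *: y) = a ^+ 2 * weight s x y;
  moment_tangent : forall s c d,
    moment s.+1 (lincomb c) - (2 * s.+1)%:R * polar s (lincomb c) (lincomb d)
    <= moment s.+1 (lincomb c - lincomb d);
  polar_trapezoid : forall s c d (x := lincomb c) (y := lincomb d),
    polar s x (x - y) - polar s y (x - y)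
    <= (2 * s).+1%:R / 2 * (weight s x (x - y) + weight s y (x - y)) }.

Definition flip (i : I) (e : {ffun I -> bool}) : {ffun I -> bool} :=
  [ffun j => if j == i then ~~ e j else e j].

Definition signed (c : I -> R) (e : {ffun I -> bool}) : I -> R :=
  fun i => (-1) ^+ e i * c i.

Lemma lincombB c d : lincomb c - lincomb d = lincomb (fun i => c i - d i).
Proof. by rewrite -sumrB; apply: eq_bigr => i _; rewrite scalerBl. Qed.

Lemma eq_lincomb c d : c =1 d -> lincomb c = lincomb d.
Proof. by move=> cd; apply: eq_bigr => i _; rewrite cd. Qed.

Lemma flipK i : involutive (flip i).
Proof. by move=> e; apply/ffunP => j; rewrite !ffunE; case: eqP => // _; rewrite negbK. Qed.

Lemma signed_flip c e i : signed c (flip i e) i = - signed c e i.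
Proof. by rewrite /signed ffunE eqxx signrN mulNr. Qed.

Lemma lincomb_sub_flip c e i :
  lincomb (signed c e) - lincomb (signed c (flip i e)) = (2 * signed c e i) *: H i.
Proof.
rewrite lincombB /lincomb (bigD1 i) //= big1 ?addr0 => [|j ji].
  by rewrite signed_flip; congr (_ *: _); ring.
by rewrite /signed ffunE (negPf ji) subrr scale0r.
Qed.

Variables (moment : nat -> X -> R) (polar weight : nat -> X -> X -> R).
Hypothesis moments : even_moments moment polar weight.

Lemma polar_sum s x (F : I -> X) : polar s x (\sum_i F i) = \sum_i polar s x (F i).
Proof.
apply: (big_morph (polar s x)) => [y z|]; first exact: polarD moments _ _ _ _.
by rewrite -(scale0r (0 : X)) (polarZ moments) mul0r.
Qed.

Section RandomSigns.
Variable c : I -> R.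
Let D e := lincomb (signed c e).

Lemma sum_polar_flip s i :
  \sum_e polar s (D e) (signed c e i *: H i) =
  \sum_e 4^-1 * (polar s (D e) (D e - D (flip i e)) -
                 polar s (D (flip i e)) (D e - D (flip i e))).
Proof.
have flipped : \sum_e polar s (D e) (signed c e i *: H i) =
    \sum_e - polar s (D (flip i e)) (signed c e i *: H i).
  rewrite (reindex_inj (inv_inj (flipK i))) /=; apply: eq_bigr => e _.
  by rewrite signed_flip !(polarZ moments) mulNr.
transitivity (2^-1 * (\sum_e polar s (D e) (signed c e i *: H i) +
    \sum_e - polar s (D (flip i e)) (signed c e i *: H i))); first by rewrite -flipped; field.
rewrite -big_split /= mulr_sumr; apply: eq_bigr => e _.
by rewrite /D lincomb_sub_flip !(polarZ moments); field.
Qed.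

Lemma sum_weight_flip s i :
  \sum_e weight s (D (flip i e)) (signed c e i *: H i) =
  \sum_e weight s (D e) (signed c e i *: H i).
Proof.
rewrite [RHS](reindex_inj (inv_inj (flipK i))) /=; apply: eq_bigr => e _.
by rewrite signed_flip !(weightZ moments) sqrrN.
Qed.

Lemma sum_polar_le s i :
  \sum_e polar s (D e) (signed c e i *: H i) <=
  (2 * s).+1%:R * \sum_e weight s (D e) (signed c e i *: H i).
Proof.
rewrite sum_polar_flip.
apply: le_trans (_ : \sum_e (2 * s).+1%:R / 2 * (weight s (D e) (signed c e i *: H i) +
    weight s (D (flip i e)) (signed c e i *: H i)) <= _).
  apply: ler_sum => e _; have := polar_trapezoid moments s (signed c e) (signed c (flip i e)).
  by rewrite /= -/(D _) -/(D _) /D lincomb_sub_flip !(weightZ moments) exprMn; lra.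
by rewrite -mulr_sumr big_split /= sum_weight_flip; lra.
Qed.

Variable beta : R.
Hypothesis weight_le : forall s d,
  \sum_i c i ^+ 2 * weight s (lincomb d) (H i) <= beta * moment s (lincomb d).

Lemma khintchine_step s :
  \sum_e moment s.+1 (D e) <= (2 * s).+1%:R * beta * \sum_e moment s (D e).
Proof.
have -> : \sum_e moment s.+1 (D e) = \sum_i \sum_e polar s (D e) (signed c e i *: H i).
  rewrite exchange_big; apply: eq_bigr => e _.
  by rewrite /D (momentS moments) {2}/lincomb polar_sum.
apply: le_trans (ler_sum _ (fun i _ => sum_polar_le s i)) _.
rewrite -mulr_sumr -mulrA ler_wpM2l ?ler0n // exchange_big /= mulr_sumr.
apply: ler_sum => e _; apply: le_trans (weight_le s (signed c e)).
by apply: ler_sum => i _; rewrite (weightZ moments) /signed exprMn sqrr_sign mul1r.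
Qed.

Lemma khintchine (M : R) s : 0 <= beta -> (forall d, moment 0 (lincomb d) <= M) ->
  \sum_e moment s (D e) <= ((2 * s)%:R * beta) ^+ s * \sum_(e : {ffun I -> bool}) M.
Proof.
move=> beta0 moment0_le; suff bound t : (t <= s)%N ->
    \sum_e moment t (D e) <= ((2 * s)%:R * beta) ^+ t * \sum_(e : {ffun I -> bool}) M.
  exact: bound.
elim: t => [_|t IH ts]; first by rewrite mul1r; apply: ler_sum => e _; exact: moment0_le.
apply: le_trans (khintchine_step t) _; rewrite exprS -[leRHS]mulrA.
apply: ler_pM => //; last exact: IH (ltnW ts).
- by rewrite mulr_ge0 ?ler0n.
- by apply: sumr_ge0 => e _; exact: moment_ge0 moments _ _.
by apply: ler_wpM2r => //; rewrite ler_nat; lia.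
Qed.

End RandomSigns.

Section IndependentCopy.
Variable p : R.
Hypothesis p01 : 0 < p <= 1.

Let p01W : 0 <= p <= 1. Proof. exact: gt0_le1W. Qed.

Lemma expect_polar_centered s x : expect p (fun w => polar s x (lincomb (centered p w))) = 0.
Proof.
transitivity (\sum_i expect p (fun w => centered p w i * polar s x (H i))).
  rewrite -expect_sum; apply: eq_expect => w; rewrite polar_sum.
  by apply: eq_bigr => i _; rewrite (polarZ moments).
rewrite big1 // => i _; rewrite expectMr expect_centered ?mul0r //.
by rewrite lt0r_neq0 //; case/andP: p01.
Qed.

Lemma moment_symmetrization s :
  expect p (fun w => moment s.+1 (lincomb (centered p w))) <=
  expect p (fun w => expect p (fun w' => moment s.+1 (lincomb (increment p w w')))).
Proof.
apply: expect_le => // w.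
apply: le_trans (_ : expect p (fun w' => moment s.+1 (lincomb (centered p w)) +
    - (2 * s.+1)%:R * polar s (lincomb (centered p w)) (lincomb (centered p w'))) <= _).
  by rewrite expectD expectZ expect_polar_centered mulr0 addr0 expect_cst.
apply: expect_le => // w'; rewrite mulNr; apply: le_trans (moment_tangent moments _ _ _) _.
rewrite lincombB (@eq_lincomb _ (increment p w w')) // => i.
by rewrite /centered /increment; ring.
Qed.

Lemma expect_random_signs s (e : {ffun I -> bool}) :
  expect p (fun w => expect p (fun w' => moment s (lincomb (increment p w w')))) =
  expect p (fun w => expect p (fun w' => moment s (lincomb (signed (increment p w w') e)))).
Proof.
rewrite (expect_splice_swap p (fun i => ~~ e i)); apply: eq_expect => w; apply: eq_expect => w'.
congr (moment _); apply: eq_lincomb => i; rewrite /signed /increment !ffunE.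
by case: (e i); rewrite /= ?expr0 ?expr1; ring.
Qed.

Lemma symmetrized_moment_le (M : R) (beta : {ffun I -> bool} -> {ffun I -> bool} -> R) s :
  (0 < s)%N -> (forall w w', 0 <= beta w w') ->
  (forall w w' s d, \sum_i increment p w w' i ^+ 2 * weight s (lincomb d) (H i)
                    <= beta w w' * moment s (lincomb d)) ->
  (forall d, moment 0 (lincomb d) <= M) ->
  expect p (fun w => moment s (lincomb (centered p w))) <=
  M * expect p (fun w => expect p (fun w' => ((2 * s)%:R * beta w w') ^+ s)).
Proof.
case: s => // s _ beta0 weight_le moment0_le.
have card_gt0 : 0 < #|{ffun I -> bool}|%:R :> R.
  by rewrite ltr0n card_ffun expn_gt0 card_bool.
apply: le_trans (moment_symmetrization s) _; rewrite -(ler_pM2l card_gt0).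
rewrite mulr_natl -sumr_const (eq_bigr _ (fun e _ => expect_random_signs s.+1 e)).
rewrite -expect_sum mulrA -expectZ; apply: expect_le => // w.
rewrite -expect_sum -expectZ; apply: expect_le => // w'.
apply: le_trans (khintchine (weight_le w w') s.+1 (beta0 w w') moment0_le) _.
by rewrite sumr_const mulrC [#|_|%:R * M]mulr_natl.
Qed.

End IndependentCopy.
End Symmetrization.

Section VectorTail.
Variables (R : realType) (I : finType) (a b : nat) (H : I -> 'M[R]_(a, b)).

Lemma sqnorm_even_moments : even_moments H (fun s x => sqnorm x ^+ s)
  (fun s x y => sqnorm x ^+ s * fdot x y) (fun s x h => sqnorm x ^+ s * sqnorm h).
Proof.
split=> [s c|s c|s x y z|s x t y|s x t y|s c d|s c d] /=.
- by rewrite exprn_ge0 ?sqnorm_ge0.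
- by rewrite exprSr.
- by rewrite fdotDr mulrDr.
- by rewrite fdotZr mulrCA.
- by rewrite sqnormZ mulrCA.
- move: (lincomb H c) (lincomb H d) => x y.
  apply: le_trans (exprS_tangent_le s (sqnorm_ge0 (x - y)) (sqnorm_ge0 x)).
  have : 0 <= s.+1%:R * (sqnorm x ^+ s * sqnorm y).
    by rewrite !mulr_ge0 ?exprn_ge0 ?sqnorm_ge0.
  by rewrite sqnormB natrM; lra.
- move: (lincomb H c) (lincomb H d) => x y.
  have := expr_odd_trapezoid_le (fnorm x) (fnorm y) s.
  have : 0 <= (2 * s)%:R * (fnorm x * fnorm y - fdot x y) * (sqnorm x ^+ s + sqnorm y ^+ s).
    apply: mulr_ge0; last by rewrite addr_ge0 ?exprn_ge0 ?sqnorm_ge0.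
    by rewrite mulr_ge0 // subr_ge0 fdot_le_fnorm.
  rewrite sqnormB !fdotDr !fdotNr -!/(sqnorm _) (fdotC y x) !exprS !exprM !fnorm_sq -natr1.
  by rewrite -!fnorm_sq; lra.
Qed.

Variables (p : R) (s : nat).
Hypotheses (s0 : (0 < s)%N) (p01 : 0 < p <= 1).

Let p01W : 0 <= p <= 1. Proof. exact: gt0_le1W. Qed.

Lemma vector_moment (v : R) : 0 < v -> variance_proxy p s (fun x => sqnorm (H x)) v ->
  expect p (fun w => sqnorm (lincomb H (centered p w)) ^+ s) <= (expR 2 * (4 * s%:R * v)) ^+ s.
Proof.
move=> v0 proxy; have /andP[p0 _] := p01.
have sq_ge0 x : 0 <= sqnorm (H x) := sqnorm_ge0 (H x).
apply: le_trans (paired_sum_proxy_moment_le p01W p0 v0 sq_ge0 proxy).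
rewrite -[leRHS]mul1r; apply: (symmetrized_moment_le sqnorm_even_moments) => //.
- by move=> w w'; apply: paired_sum_ge0 => x; exact: divr_ge0 (sq_ge0 x) (sqr_ge0 p).
- move=> w w' k d; rewrite (eq_bigr (fun x => increment p w w' x ^+ 2 * sqnorm (H x) *
    sqnorm (lincomb H d) ^+ k)) => [|x _]; last by rewrite /=; ring.
  rewrite -mulr_suml; apply: ler_wpM2r; first by rewrite exprn_ge0 ?sqnorm_ge0.
  exact: sum_sq_increment_le.
Qed.

Lemma vector_tail (v : R) : 0 <= v -> variance_proxy p s (fun x => sqnorm (H x)) v ->
  prob p (fun w => tail_level s v < sqnorm (lincomb H (centered p w))) <= expR (- s%:R).
Proof.
rewrite le_eqVlt => /predU1P[<-|v0] proxy; last first.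
  have u0 : 0 < 4 * s%:R * v by rewrite !mulr_gt0 ?ltr0n.
  rewrite -[leRHS]mul1r.
  pose F (w : {ffun I -> bool}) := sqnorm (lincomb H (centered p w)) ^+ s.
  apply: le_trans (prob_moment_tail (F := F) p01W u0 _ _) => [|w|].
  - apply: prob_le => // w; rewrite -(ltr_pXn2r s0) ?nnegrE ?sqnorm_ge0 //.
    exact/tail_level_ge0/ltW.
  - by rewrite /F exprn_ge0 ?sqnorm_ge0.
  by rewrite mul1r; exact: vector_moment.
rewrite prob_never ?expR_ge0 // => w; rewrite /tail_level !mulr0 /lincomb big1 => [|x _].
  by rewrite sqnorm0 ltxx.
suff /sqnorm_eq0-> : sqnorm (H x) = 0 by rewrite scaler0.
have /andP[p0 _] := p01; have [_ /(_ x)] := proxy.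
rewrite mulrA pmulr_lle0 ?invr_gt0 ?exprn_gt0 // pmulr_rle0 ?ltr0n // => le0.
by apply/eqP; rewrite eq_le le0 sqnorm_ge0.
Qed.

End VectorTail.

Section TraceInequalities.
Variables (R : rcfType) (n : nat).
Implicit Types (X Y A V W : 'M[R]_n) (l k : 'rV[R]_n).

Lemma expmx_sym X m : X^T = X -> (X ^+ m)^T = X ^+ m.
Proof.
move=> Xs; elim: m => [|m IH]; first by rewrite expr0 trmx1.
by rewrite {1}exprS -[X * _]/(X *m _) trmx_mul IH Xs exprSr.
Qed.

Lemma expmx_even_diag_ge0 X m i : X^T = X -> 0 <= (X ^+ (2 * m)) i i.
Proof.
move=> Xs; rewrite mulnC exprM expr2 -[_ * _]/(_ *m _) mxE; apply: sumr_ge0 => j _.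
by rewrite -{1}(expmx_sym m Xs) mxE -expr2 sqr_ge0.
Qed.

Lemma eigenbasis_exp X V l m :
  eigenbasis X V l -> eigenbasis (X ^+ m) V (\row_i l 0 i ^+ m).
Proof.
move=> Vl; have [VV VX] := Vl; split=> //.
have VXm : V^T *m X ^+ m = diag_mx (\row_i l 0 i ^+ m) *m V^T.
  elim: m => [|m IH].
    by rewrite expr0 mulmx1 (_ : diag_mx _ = 1%:M) ?mul1mx //; apply/matrixP => i j; rewrite !mxE.
  rewrite exprSr -[_ * X]/(_ *m X) mulmxA IH (eigenbasis_decomp Vl) !mulmxA.
  rewrite -(mulmxA _ V^T V) VV mulmx1 mulmx_diag.
  by congr (diag_mx _ *m _); apply/rowP => i; rewrite !mxE exprSr.
by rewrite VXm -mulmxA VV mulmx1.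
Qed.

Lemma eigenbasis_mull X V l A W i j : eigenbasis X V l ->
  (V^T *m (X *m A) *m W) i j = l 0 i * (V^T *m A *m W) i j.
Proof.
move=> Vl; have [VV _] := Vl; rewrite {1}(eigenbasis_decomp Vl) !mulmxA VV mul1mx -!mulmxA.
by rewrite mul_diag_mx mxE.
Qed.

Lemma eigenbasis_mulr Y W k A V i j : eigenbasis Y W k ->
  (V^T *m (A *m Y) *m W) i j = (V^T *m A *m W) i j * k 0 j.
Proof.
move=> Wk; have [WW _] := Wk; rewrite {1}(eigenbasis_decomp Wk) -!mulmxA WW mulmx1 !mulmxA.
by rewrite mul_mx_diag mxE.
Qed.

Lemma trace_rotate V W A B : orthonormal_cols V -> orthonormal_cols W ->
  \tr (A *m B^T) = fdot (V^T *m A *m W) (V^T *m B *m W).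
Proof.
move=> VV WW; rewrite -!mulmxA fdot_isometry; last exact: orthonormal_colsT.
rewrite fdot_trace trmx_mul mulmxA -(mulmxA A W).
by rewrite (mulmx1C WW) mulmx1.
Qed.

Section Overlap.
Variables (X Y V W : 'M[R]_n) (l k : 'rV[R]_n).
Hypotheses (Vl : eigenbasis X V l) (Wk : eigenbasis Y W k).

Definition overlap (F : R -> R -> R) : R :=
  \sum_i \sum_j (V^T *m W) i j ^+ 2 * F (l 0 i) (k 0 j).

Lemma overlapD F G : overlap (fun x y => F x y + G x y) = overlap F + overlap G.
Proof.
rewrite -big_split; apply: eq_bigr => i _ /=; rewrite -big_split.
by apply: eq_bigr => j _; rewrite /= mulrDr.
Qed.

Lemma overlapZ c F : overlap (fun x y => c * F x y) = c * overlap F.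
Proof.
rewrite mulr_sumr; apply: eq_bigr => i _; rewrite mulr_sumr.
by apply: eq_bigr => j _; rewrite mulrCA.
Qed.

Lemma le_overlap F G : (forall x y, F x y <= G x y) -> overlap F <= overlap G.
Proof.
move=> FG; do 2![apply: ler_sum => ? _].
by apply: ler_wpM2l; [exact: sqr_ge0|exact: FG].
Qed.

Let rotated_sub i j : (V^T *m (X - Y) *m W) i j = (l 0 i - k 0 j) * (V^T *m W) i j.
Proof.
rewrite -[X]mulmx1 -[Y]mul1mx mulmxBr mulmxBl.
rewrite mxE [(- _ : 'M[R]_n) i j]mxE (eigenbasis_mull _ _ _ _ Vl) (eigenbasis_mulr _ _ _ _ Wk).
by rewrite mulmx1 mulrBl [k 0 j * _]mulrC.
Qed.

Let trace_expmx_left m A B : \tr (X ^+ m *m A *m B^T) =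
  \sum_i \sum_j l 0 i ^+ m * (V^T *m A *m W) i j * (V^T *m B *m W) i j.
Proof.
rewrite (trace_rotate _ _ (proj1 Vl) (proj1 Wk)); apply: eq_bigr => i _; apply: eq_bigr => j _.
by rewrite (eigenbasis_mull _ _ _ _ (eigenbasis_exp m Vl)) mxE.
Qed.

Let trace_expmx_right m A B : \tr (A *m Y ^+ m *m B^T) =
  \sum_i \sum_j k 0 j ^+ m * (V^T *m A *m W) i j * (V^T *m B *m W) i j.
Proof.
rewrite (trace_rotate _ _ (proj1 Vl) (proj1 Wk)); apply: eq_bigr => i _; apply: eq_bigr => j _.
rewrite (eigenbasis_mulr _ _ _ _ (eigenbasis_exp m Wk)).
by rewrite [(\row_c _) 0 j]mxE [_ * k 0 j ^+ m]mulrC.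
Qed.

Lemma trace_expmx_overlap m : \tr (X ^+ m) = overlap (fun x _ => x ^+ m).
Proof.
rewrite -[X ^+ m]mulmx1 -[X ^+ m *m _]mulmx1 -{2}trmx1 trace_expmx_left.
by do 2![apply: eq_bigr => ? _]; rewrite mulmx1; ring.
Qed.

Lemma trace_expmxr_overlap m : \tr (Y ^+ m) = overlap (fun _ y => y ^+ m).
Proof.
rewrite -[Y ^+ m]mul1mx -[_ *m Y ^+ m]mulmx1 -{2}trmx1 trace_expmx_right.
by do 2![apply: eq_bigr => ? _]; rewrite mulmx1; ring.
Qed.

Lemma trace_expmx_sub_overlap m :
  \tr (X ^+ m *m (X - Y)) = overlap (fun x y => x ^+ m * (x - y)).
Proof.
rewrite -[_ *m (X - Y)]mulmx1 -trmx1 trace_expmx_left.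
by do 2![apply: eq_bigr => ? _]; rewrite rotated_sub mulmx1; ring.
Qed.

Lemma trace_expmxr_sub_overlap m :
  \tr (Y ^+ m *m (X - Y)) = overlap (fun x y => y ^+ m * (x - y)).
Proof.
rewrite mxtrace_mulC -[_ *m Y ^+ m]mulmx1 -trmx1 trace_expmx_right.
by do 2![apply: eq_bigr => ? _]; rewrite rotated_sub mulmx1; ring.
Qed.

Hypothesis XY_sym : (X - Y)^T = X - Y.

Lemma trace_expmx_sq_sub_overlap m :
  \tr (X ^+ m *m ((X - Y) *m (X - Y))) = overlap (fun x y => x ^+ m * (x - y) ^+ 2).
Proof.
rewrite mulmxA -{2}XY_sym trace_expmx_left.
by do 2![apply: eq_bigr => ? _]; rewrite rotated_sub; ring.
Qed.

Lemma trace_expmxr_sq_sub_overlap m :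
  \tr (Y ^+ m *m ((X - Y) *m (X - Y))) = overlap (fun x y => y ^+ m * (x - y) ^+ 2).
Proof.
rewrite mulmxA mxtrace_mulC mulmxA -{2}XY_sym trace_expmx_right.
by do 2![apply: eq_bigr => ? _]; rewrite rotated_sub; ring.
Qed.

End Overlap.

Lemma trace_expmx_tangent X Y s : X^T = X -> Y^T = Y ->
  \tr (X ^+ (2 * s.+1)) - (2 * s.+1)%:R * \tr (X ^+ (2 * s).+1 *m Y)
  <= \tr ((X - Y) ^+ (2 * s.+1)).
Proof.
move=> Xs Ys; have Ds : (X - Y)^T = X - Y by rewrite linearB /= Xs Ys.
have [V [l Vl]] := symmetric_eigenbasis Xs; have [W [k Wk]] := symmetric_eigenbasis Ds.
rewrite -{1}(subKr X Y) (trace_expmx_overlap Vl Wk) (trace_expmxr_overlap Vl Wk).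
rewrite (trace_expmx_sub_overlap Vl Wk) -mulNr -overlapZ -overlapD.
by apply: le_overlap => x y; have := expr_even_tangent_le x y s; lra.
Qed.

Lemma trace_expmx_trapezoid X Y s : X^T = X -> Y^T = Y ->
  \tr (X ^+ (2 * s).+1 *m (X - Y)) - \tr (Y ^+ (2 * s).+1 *m (X - Y)) <=
  (2 * s).+1%:R / 2 * (\tr (X ^+ (2 * s) *m ((X - Y) *m (X - Y))) +
                       \tr (Y ^+ (2 * s) *m ((X - Y) *m (X - Y)))).
Proof.
move=> Xs Ys; have Ds : (X - Y)^T = X - Y by rewrite linearB /= Xs Ys.
have [V [l Vl]] := symmetric_eigenbasis Xs; have [W [k Wk]] := symmetric_eigenbasis Ys.
rewrite (trace_expmx_sub_overlap Vl Wk) (trace_expmxr_sub_overlap Vl Wk).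
rewrite (trace_expmx_sq_sub_overlap Vl Wk Ds) (trace_expmxr_sq_sub_overlap Vl Wk Ds).
rewrite -mulN1r -!overlapZ -!overlapD -overlapZ.
by apply: le_overlap => x y; have := expr_odd_trapezoid_le x y s; lra.
Qed.

Lemma opnorm_le_trace X (t : R) s : (0 < s)%N -> X^T = X -> 0 <= t ->
  \tr (X ^+ (2 * s)) <= t ^+ s -> opnorm_le X (Num.sqrt t).
Proof.
move=> s0 Xs t0 tr_le x; have [V [l Vl]] := symmetric_eigenbasis Xs; have [VV _] := Vl.
have l_le i : l 0 i ^+ 2 <= t.
  rewrite -(ler_pXn2r s0) ?nnegrE ?sqr_ge0 //; apply: le_trans tr_le.
  rewrite (eigenbasis_decomp (eigenbasis_exp (2 * s) Vl)) -mulmxA mxtrace_mulC -mulmxA VV mulmx1.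
  rewrite mxtrace_diag (bigD1 i) //= mxE exprM lerDl; apply: sumr_ge0 => j _.
  by rewrite mxE exprM exprn_ge0 ?sqr_ge0.
rewrite sqr_sqrtr // (eigenbasis_decomp Vl) -!mulmxA sqnorm_isometry //.
rewrite -(sqnorm_isometry x (orthonormal_colsT VV)) mul_diag_mx !sqnormE mulr_sumr.
apply: ler_sum => i _; rewrite !big_ord1 mxE exprMn.
by apply: ler_wpM2r; [exact: sqr_ge0|exact: l_le].
Qed.

End TraceInequalities.

Section MatrixTail.
Variables (R : realType) (I : finType) (n : nat) (H : I -> 'M[R]_n).
Hypothesis Hsym : forall x, (H x)^T = H x.

Lemma lincomb_sym c : (lincomb H c)^T = lincomb H c.
Proof.
by rewrite /lincomb linear_sum; apply: eq_bigr => x _; rewrite linearZ /= Hsym.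
Qed.

Lemma trace_even_moments : even_moments H (fun s X => \tr (X ^+ (2 * s)))
  (fun s X Y => \tr (X ^+ (2 * s).+1 *m Y)) (fun s X Y => \tr (X ^+ (2 * s) *m (Y *m Y))).
Proof.
split=> [s c|s c|s x y z|s x t y|s x t y|s c d|s c d] /=.
- by apply: sumr_ge0 => i _; apply: expmx_even_diag_ge0; exact: lincomb_sym.
- by rewrite -[_ *m _]/(_ * _) -exprSr; congr (\tr (_ ^+ _)); lia.
- by rewrite mulmxDr raddfD.
- by rewrite -scalemxAr mxtraceZ.
- by rewrite -scalemxAl -!scalemxAr scalerA mxtraceZ expr2.
- by apply: trace_expmx_tangent; exact: lincomb_sym.
- by apply: trace_expmx_trapezoid; exact: lincomb_sym.
Qed.

Hypothesis Hsq_diag : forall x, is_diag_mx (H x *m H x).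

Lemma trace_mul_sq P x : \tr (P *m (H x *m H x)) = \sum_i P i i * sqnorm (row i (H x)).
Proof.
rewrite /mxtrace; apply: eq_bigr => i _; rewrite mxE (bigD1 i) //= big1 ?addr0 => [|j ji].
  congr (_ * _); rewrite mxE sqnorm_rV; apply: eq_bigr => j _.
  by rewrite !mxE -{2}(Hsym x) mxE expr2.
by rewrite (is_diag_mxP (Hsq_diag x)) ?mulr0.
Qed.

Variables (p v : R) (s : nat).
Hypotheses (s0 : (0 < s)%N) (p01 : 0 < p <= 1) (v0 : 0 < v).
Hypothesis row_proxy : forall i, variance_proxy p s (fun x => sqnorm (row i (H x))) v.

Let p01W : 0 <= p <= 1. Proof. exact: gt0_le1W. Qed.

Let row_paired_sum i (w w' : {ffun I -> bool}) : R :=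
  paired_sum (fun x => sqnorm (row i (H x)) / p ^+ 2) w w'.

Let row_paired_sum_ge0 i w w' : 0 <= row_paired_sum i w w'.
Proof. by apply: paired_sum_ge0 => x; exact: divr_ge0 (sqnorm_ge0 _) (sqr_ge0 p). Qed.

Let max_paired_sum w w' : R := \big[Num.max/0]_i row_paired_sum i w w'.

Lemma sum_increment_weight_le w w' k d :
  \sum_x increment p w w' x ^+ 2 * \tr (lincomb H d ^+ (2 * k) *m (H x *m H x)) <=
  max_paired_sum w w' * \tr (lincomb H d ^+ (2 * k)).
Proof.
have P0 i : 0 <= (lincomb H d ^+ (2 * k)) i i.
  by apply: expmx_even_diag_ge0; exact: lincomb_sym.
under eq_bigr do rewrite trace_mul_sq mulr_sumr.
rewrite exchange_big /= /mxtrace mulr_sumr; apply: ler_sum => i _.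
under eq_bigr do rewrite mulrCA; rewrite -mulr_sumr mulrC; apply: ler_wpM2r => //.
apply: le_trans (sum_sq_increment_le p w w' (fun x => sqnorm_ge0 (row i (H x)))) _.
exact: (le_bigmax 0 (fun i => row_paired_sum i w w') i).
Qed.

Lemma matrix_moment :
  expect p (fun w => \tr (lincomb H (centered p w) ^+ (2 * s))) <=
  n%:R ^+ 2 * (expR 2 * (4 * s%:R * v)) ^+ s.
Proof.
have /andP[p0 _] := p01.
apply: le_trans (symmetrized_moment_le trace_even_moments p01 s0 (M := n%:R)
  (beta := max_paired_sum) _ _ _) _.
- by move=> w w'; rewrite /max_paired_sum; elim/big_rec: _ => // i x _ x0; rewrite le_max x0 orbT.
- exact: sum_increment_weight_le.
- by move=> d; rewrite muln0 expr0 mxtrace1.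
rewrite expr2 -mulrA; apply: ler_wpM2l; first exact: ler0n.
apply: le_trans (_ : \sum_i expect p (fun w => expect p (fun w' =>
    ((2 * s)%:R * row_paired_sum i w w') ^+ s)) <= _).
  rewrite -expect_sum; apply: expect_le => // w; rewrite -expect_sum; apply: expect_le => // w'.
  under eq_bigr do rewrite exprMn; rewrite exprMn -mulr_sumr.
  by apply: ler_wpM2l; [nonneg|exact: expr_bigmax_le_sum].
apply: le_trans (ler_sum _ (fun i _ => paired_sum_proxy_moment_le p01W p0 v0
  (fun x => sqnorm_ge0 (row i (H x))) (row_proxy i))) _.
by rewrite sumr_const card_ord -[_ *+ n]mulr_natl.
Qed.

Lemma matrix_tail :
  prob p (fun w => ~ opnorm_le (lincomb H (centered p w)) (Num.sqrt (tail_level s v)))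
  <= n%:R ^+ 2 * expR (- s%:R).
Proof.
have u0 : 0 < 4 * s%:R * v by rewrite !mulr_gt0 ?ltr0n.
pose F (w : {ffun I -> bool}) := \tr (lincomb H (centered p w) ^+ (2 * s)).
apply: le_trans (prob_moment_tail (F := F) p01W u0 _ matrix_moment) => [|w]; last first.
  by apply: sumr_ge0 => i _; apply: expmx_even_diag_ge0; exact: lincomb_sym.
apply: prob_le => // w; apply: contra_notP => /negP; rewrite -leNgt.
apply: opnorm_le_trace => //; first exact: lincomb_sym.
exact/tail_level_ge0/ltW.
Qed.

End MatrixTail.

Lemma capmx_neq0 (F : fieldType) m1 m2 n (A : 'M[F]_(m1, n)) (B : 'M[F]_(m2, n)) :
  (n < \rank A + \rank B)%N -> exists x : 'rV[F]_n, [/\ x != 0, (x <= A)%MS & (x <= B)%MS].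
Proof.
move=> n_lt; have : (A :&: B)%MS != 0.
  rewrite -mxrank_eq0 -lt0n -(ltn_add2l (\rank (A + B)%MS)) addn0 mxrank_sum_cap.
  exact: leq_ltn_trans (rank_leq_col _) n_lt.
by case/rowV0Pn => x; rewrite sub_capmx => /andP[xA xB] x0; exists x.
Qed.

Lemma mul_mx_pidE (S : pzSemiRingType) m n p r (M : 'M[S]_(m, n)) i (k : 'I_n) (j : 'I_p) :
  val k = val j -> (M *m pid_mx r) i j = if (j < r)%N then M i k else 0.
Proof.
move=> kj; rewrite mxE (bigD1 k) //= big1 ?addr0 => [|l lk].
  by rewrite mxE kj eqxx; case: ltnP; rewrite ?mulr1 ?mulr0.
by rewrite mxE -kj val_eqE (negPf lk) mulr0.
Qed.

Lemma mul_pid_mxE (S : comPzSemiRingType) m n p r (M : 'M[S]_(m, n)) (i : 'I_p) (k : 'I_m) j :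
  val k = val i -> (pid_mx r *m M) i j = if (i < r)%N then M k j else 0.
Proof.
move=> ki; rewrite -[pid_mx r *m M]trmxK trmx_mul tr_pid_mx mxE.
by rewrite (mul_mx_pidE _ _ _ ki) mxE.
Qed.

Section CourantFischer.
Variables (R : rcfType) (n : nat) (Z V : 'M[R]_n) (lam : 'rV[R]_n).

Lemma quadform_eigenbasis x : eigenbasis Z V lam ->
  quadform Z x = \sum_i lam 0 i * (x *m V) 0 i ^+ 2.
Proof. by move=> Vlam; rewrite (eigenbasis_decomp Vlam) quadform_conj quadform_diag. Qed.

Lemma sqnorm_orthonormal_coords (x : 'rV[R]_n) : orthonormal_cols V ->
  sqnorm x = \sum_i (x *m V) 0 i ^+ 2.
Proof.
move=> VV; rewrite -sqnorm_rV -[V]trmxK sqnorm_mul_trmx_isometry //.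
exact: orthonormal_colsT.
Qed.

Lemma mxrank_mul_orthonormal m (M : 'M[R]_(m, n)) :
  orthonormal_cols V -> \rank (M *m V^T) = \rank M.
Proof. by move=> VV; apply: mxrankMfree; rewrite row_free_unit; case/mulmx1_unit: VV. Qed.

Hypothesis Vlam : sorted_eigenbasis Z V lam.

Let VV : orthonormal_cols V := proj1 (proj1 Vlam).

Lemma courant_fischer_ge m (W : 'M[R]_(m, n)) t (j : 'I_n) : (j < \rank W)%N ->
  (forall x : 'rV_n, (x <= W)%MS -> t * sqnorm x <= quadform Z x) -> t <= lam 0 j.
Proof.
move=> jW quad_ge; have jn := ltn_ord j.
have [|x [/sqnorm_gt0 x_gt0 xW /submxP[D xD]]] := @capmx_neq0 _ _ _ _ W (copid_mx j *m V^T).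
  by rewrite mxrank_mul_orthonormal // rank_copid_mx ?(ltnW jn) //; lia.
have xV0 (i : 'I_n) : (i < j)%N -> (x *m V) 0 i = 0.
  move=> ij; rewrite xD -!mulmxA VV mulmx1 mulmxBr mulmx1 mxE [(- _ : 'rV_n) 0 i]mxE.
  by rewrite (mul_mx_pidE _ _ _ (erefl (val i))) ij subrr.
rewrite -(ler_pM2r x_gt0); apply: le_trans (quad_ge x xW) _.
rewrite (quadform_eigenbasis _ (proj1 Vlam)) (sqnorm_orthonormal_coords _ VV) mulr_sumr.
apply: ler_sum => i _; have [ij|ji] := ltnP i j; first by rewrite xV0 // expr0n !mulr0.
by apply: ler_wpM2r; [exact: sqr_ge0|exact: (proj2 Vlam)].
Qed.

Lemma courant_fischer_le m (K : 'M[R]_(m, n)) t (j : 'I_n) : (n <= j + \rank K)%N ->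
  (forall x : 'rV_n, (x <= K)%MS -> quadform Z x <= t * sqnorm x) -> lam 0 j <= t.
Proof.
move=> jK quad_le; have jn := ltn_ord j.
have [|x [/sqnorm_gt0 x_gt0 xK /submxP[D xD]]] :=
    @capmx_neq0 _ _ _ _ K ((pid_mx j.+1 : 'M[R]_n) *m V^T).
  by rewrite mxrank_mul_orthonormal // rank_pid_mx //; lia.
have xV0 (i : 'I_n) : (j < i)%N -> (x *m V) 0 i = 0.
  move=> ji; rewrite xD -!mulmxA VV mulmx1.
  by rewrite (mul_mx_pidE _ _ _ (erefl (val i))) ltnS leqNgt ji.
rewrite -(ler_pM2r x_gt0); apply: le_trans (quad_le x xK).
rewrite (quadform_eigenbasis _ (proj1 Vlam)) (sqnorm_orthonormal_coords _ VV) mulr_sumr.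
apply: ler_sum => i _; have [ji|ij] := ltnP j i; first by rewrite xV0 // expr0n !mulr0.
by apply: ler_wpM2r; [exact: sqr_ge0|exact: (proj2 Vlam)].
Qed.

End CourantFischer.

Section TopProjection.
Variable R : rcfType.

Definition topcols n r (V : 'M[R]_n) : 'M[R]_(n, r) := V *m pid_mx r.

Definition topproj n r (V : 'M[R]_n) : 'M[R]_n := topcols r V *m (topcols r V)^T.

Lemma orthonormal_topcols n r (V : 'M[R]_n) :
  (r <= n)%N -> orthonormal_cols V -> orthonormal_cols (topcols r V).
Proof.
move=> rn VV; apply: orthonormal_cols_mul => //.
by rewrite /orthonormal_cols tr_pid_mx mul_pid_mx minnn (minn_idPr rn) pid_mx_1.
Qed.

Lemma orthoproj_topproj n r (V : 'M[R]_n) :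
  (r <= n)%N -> orthonormal_cols V -> orthoproj (topproj r V).
Proof. by move=> rn VV; apply: orthoproj_gram; exact: orthonormal_topcols. Qed.

Lemma sqnorm_mul_topproj m n r (V : 'M[R]_n) (M : 'M[R]_(m, n)) :
  (r <= n)%N -> orthonormal_cols V -> sqnorm (M *m topproj r V) = sqnorm (M *m topcols r V).
Proof.
move=> rn VV; rewrite /topproj mulmxA sqnorm_mul_trmx_isometry //.
exact: orthonormal_topcols.
Qed.

Lemma mul_topcols n r (Z V : 'M[R]_n) (lam : 'rV[R]_n) (rn : (r <= n)%N) :
  eigenbasis Z V lam ->
  Z *m topcols r V = topcols r V *m diag_mx (\row_c lam 0 (widen_ord rn c)).
Proof.
move=> Vlam; have [VV _] := Vlam.
rewrite {1}(eigenbasis_decomp Vlam) /topcols -!mulmxA (mulmxA V^T) VV mul1mx.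
congr (V *m _); apply/matrixP => i c; rewrite mul_diag_mx mul_mx_diag !mxE.
case: eqP => [ic|_]; last by rewrite mulr0 mul0r.
by rewrite mulrC; congr (_ * lam 0 _); apply: val_inj.
Qed.

Lemma trmx_mul_compl_topproj m n r (V : 'M[R]_n) (X : 'M[R]_(n, m)) :
  orthonormal_cols V ->
  V^T *m ((1%:M - topproj r V) *m X) = copid_mx r *m (V^T *m X).
Proof.
move=> VV; rewrite /topproj /topcols trmx_mul tr_pid_mx -(mulmxA V) (mulmxA (pid_mx r)) mul_pid_mx.
rewrite !minnn !mulmxA; congr (_ *m X).
by rewrite mulmxBr mulmx1 !mulmxA VV mul1mx mulmxBl mul1mx.
Qed.

(* In the bases [V], [mu] the entry [(j, c)] of [V^T (Z1 - Z2) X] is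
   [(mu_c - lam_j) (V^T X)_jc]. *)
Lemma davis_kahan n m r (Z1 Z2 V : 'M[R]_n) (lam : 'rV[R]_n) (X : 'M[R]_(n, m))
    (mu : 'rV[R]_m) (al be : R) :
  eigenbasis Z2 V lam -> Z1 *m X = X *m diag_mx mu -> be <= al ->
  (forall c, al <= mu 0 c) -> (forall j : 'I_n, (r <= j)%N -> lam 0 j <= be) ->
  (al - be) ^+ 2 * sqnorm ((1%:M - topproj r V) *m X) <= sqnorm ((Z1 - Z2) *m X).
Proof.
move=> Vlam ZX ab mu_ge lam_le; have [VV _] := Vlam.
have VVt := orthonormal_colsT VV.
rewrite -(sqnorm_isometry _ VVt) -[leRHS](sqnorm_isometry _ VVt) trmx_mul_compl_topproj //.
have -> : V^T *m ((Z1 - Z2) *m X) = V^T *m X *m diag_mx mu - diag_mx lam *m (V^T *m X).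
  rewrite mulmxBl mulmxBr ZX {1}(eigenbasis_decomp Vlam) !mulmxA VV mul1mx.
  by [].
move: (V^T *m X) => Y; rewrite !sqnormE mulr_sumr; apply: ler_sum => j _.
rewrite mulr_sumr; apply: ler_sum => c _.
rewrite mulmxBl mul1mx [in leLHS]mxE [(- _ : 'M[R]_(n, m)) j c]mxE.
rewrite (mul_pid_mxE _ _ _ (erefl (val j))).
have [jr|rj] := ltnP j r; first by rewrite subrr expr0n mulr0 sqr_ge0.
rewrite subr0 mul_mx_diag mul_diag_mx !mxE [Y j c * _]mulrC -mulrBl exprMn.
apply: ler_wpM2r; first exact: sqr_ge0.
by have lam_j := lam_le j rj; have mu_c := mu_ge c; rewrite ler_sqr ?nnegrE; lra.
Qed.

Lemma davis_kahan_topproj n r (Z1 Z2 V1 V2 : 'M[R]_n) (lam1 lam2 : 'rV[R]_n) (al be : R) :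
  (r <= n)%N -> eigenbasis Z1 V1 lam1 -> eigenbasis Z2 V2 lam2 -> be <= al ->
  (forall j : 'I_n, (j < r)%N -> al <= lam1 0 j) ->
  (forall j : 'I_n, (r <= j)%N -> lam2 0 j <= be) ->
  (al - be) ^+ 2 * sqnorm ((1%:M - topproj r V2) *m topproj r V1)
  <= sqnorm ((Z1 - Z2) *m topproj r V1).
Proof.
move=> rn Vlam1 Vlam2 ab lam1_ge lam2_le; have [VV1 _] := Vlam1.
rewrite !sqnorm_mul_topproj //.
apply: davis_kahan Vlam2 (mul_topcols rn Vlam1) ab _ lam2_le => c.
by rewrite mxE; apply: lam1_ge; exact: (ltn_ord c).
Qed.

Lemma sqnorm_sub_topproj n r (V W : 'M[R]_n) : (r <= n)%N ->
  orthonormal_cols V -> orthonormal_cols W ->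
  sqnorm (topproj r V - topproj r W) = 2 * sqnorm ((1%:M - topproj r W) *m topproj r V).
Proof.
move=> rn VV WW.
have sqnorm_r (M : 'M[R]_n) : orthonormal_cols M -> sqnorm (topproj r M) = r%:R.
  move=> MM; rewrite -[topproj r M]mul1mx sqnorm_mul_topproj // mul1mx.
  by rewrite sqnorm_orthonormal_cols //; exact: orthonormal_topcols.
have [QT QQ] := orthoproj_topproj rn WW; rewrite mulmxBl mul1mx !sqnormB !sqnorm_r //.
have -> : fdot (topproj r V) (topproj r W *m topproj r V) =
    sqnorm (topproj r W *m topproj r V).
  by rewrite /sqnorm fdot_mull QT mulmxA QQ.
have [PT PP] := orthoproj_topproj rn VV.
have -> : sqnorm (topproj r W *m topproj r V) = fdot (topproj r V) (topproj r W).
  rewrite sqnorm_trace trmx_mul PT QT -mulmxA (mulmxA (topproj r V)) PP mxtrace_mulC.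
  by rewrite -mulmxA QQ fdot_trace QT.
by ring.
Qed.

Lemma topproj_lower m n r (Z V : 'M[R]_n) lam (al : R) (X : 'M[R]_(m, n)) : (r <= n)%N -> 0 <= al ->
  eigenbasis Z V lam -> (forall j : 'I_n, (j < r)%N -> al <= lam 0 j) ->
  al * fnorm (X *m topproj r V) <= fnorm (X *m (Z *m topproj r V)).
Proof.
move=> rn al0 Vlam lam_ge; have [VV _] := Vlam.
rewrite -[leLHS]ger0_norm ?mulr_ge0 ?fnorm_ge0 // -[leRHS]ger0_norm ?fnorm_ge0 //.
rewrite -ler_sqr ?nnegrE ?normr_ge0 // !real_normK ?num_real // exprMn !fnorm_sq.
rewrite mulmxA !sqnorm_mul_topproj // -mulmxA (mul_topcols rn Vlam) mulmxA.
move: (X *m topcols r V) => Y; rewrite !sqnormE mulr_sumr.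
apply: ler_sum => i _; rewrite mulr_sumr; apply: ler_sum => c _.
rewrite mul_mx_diag !mxE mulrC exprMn; apply: ler_wpM2l; first exact: sqr_ge0.
have lam_c_ge := lam_ge (widen_ord rn c) (ltn_ord c).
by rewrite ler_sqr ?nnegrE //; exact: le_trans lam_c_ge.
Qed.

Definition is_top_projection n r (Z Q : 'M[R]_n) : Prop :=
  exists V lam, sorted_eigenbasis Z V lam /\ Q = topproj r V.

(* [0] when [Z] has no orthonormal eigenbasis. *)
Definition top_projection n r (Z : 'M[R]_n) : 'M[R]_n :=
  xget 0 [set Q | is_top_projection r Z Q]%classic.

Lemma top_projectionP n r (Z : 'M[R]_n) :
  Z^T = Z -> is_top_projection r Z (top_projection r Z).
Proof.
move=> /symmetric_sorted_eigenbasis[V [lam Vlam]].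
have topV : [set Q | is_top_projection r Z Q]%classic (topproj r V) by exists V, lam.
exact: (xgetPex 0 (ex_intro _ _ topV)).
Qed.

Lemma is_top_projection_orthoproj n r (Z Q : 'M[R]_n) :
  (r <= n)%N -> is_top_projection r Z Q -> orthoproj Q.
Proof. by move=> rn [V [lam [[[VV _] _] ->]]]; exact: orthoproj_topproj. Qed.

Lemma orthoproj_top_projection n r (Z : 'M[R]_n) :
  (r <= n)%N -> Z^T = Z -> orthoproj (top_projection r Z).
Proof. by move=> rn /(top_projectionP r); exact: is_top_projection_orthoproj. Qed.

End TopProjection.

Section LowRankPerturbation.
Variables (R : rcfType) (n r : nat) (U : 'M[R]_(n, r)) (d : 'rV[R]_r) (sig tau : R).
Hypotheses (rn : (r <= n)%N) (UU : orthonormal_cols U) (d_ge : forall c, sig <= d 0 c).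
Hypotheses (tau0 : 0 <= tau) (gap : 2 * tau < sig).
Local Notation G := (U *m diag_mx d *m U^T).
Implicit Types (E V Q : 'M[R]_n) (lam : 'rV[R]_n).

Lemma weyl_upper E V lam (j : 'I_n) : opnorm_le E tau ->
  sorted_eigenbasis (G + E) V lam -> (r <= j)%N -> lam 0 j <= tau.
Proof.
move=> Etau Vlam rj; apply: (courant_fischer_le (K := kermx U) Vlam) => [|x /sub_kermxP xU].
  by rewrite mxrank_ker; have := rank_leq_col U; have := ltn_ord j; lia.
rewrite quadformD quadform_conj xU quadform0r add0r.
exact: le_trans (ler_norm _) (quadform_opnorm_le _ tau0 Etau).
Qed.

Lemma weyl_lower E V lam (j : 'I_n) : opnorm_le E tau ->
  sorted_eigenbasis (G + E) V lam -> (j < r)%N -> sig - tau <= lam 0 j.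
Proof.
move=> Etau Vlam jr; apply: (courant_fischer_ge (W := U^T) Vlam) => [|x /submxP[u ->]].
  by rewrite mxrank_tr; have := mxrankM_maxr U^T U; rewrite UU mxrank1; lia.
have := quadform_opnorm_le (u *m U^T) tau0 Etau; rewrite ler_norml => /andP[quadE_ge _].
rewrite quadformD quadform_conj -mulmxA UU mulmx1 quadform_diag.
have : sig * sqnorm (u *m U^T) <= \sum_c d 0 c * u 0 c ^+ 2.
  rewrite sqnorm_mul_trmx_isometry // sqnorm_rV mulr_sumr; apply: ler_sum => c _.
  by apply: ler_wpM2r; [exact: sqr_ge0|exact: d_ge].
by lra.
Qed.

Lemma top_projection_lower E Q m (X : 'M[R]_(m, n)) : opnorm_le E tau ->
  is_top_projection r (G + E) Q ->
  (sig - tau) * fnorm (X *m Q) <= fnorm (X *m ((G + E) *m Q)).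
Proof.
move=> Etau [V [lam [Vlam ->]]]; have gap0 : 0 <= sig - tau by move: tau0 gap; lra.
by apply: topproj_lower rn gap0 (proj1 Vlam) _ => j; exact: weyl_lower Etau Vlam.
Qed.

Lemma top_projection_compl_le E Q : opnorm_le E tau -> is_top_projection r (G + E) Q ->
  (sig - tau) ^+ 2 * sqnorm ((1%:M - Q) *m U) <= tau ^+ 2 * r%:R.
Proof.
move=> Etau [V [lam [Vlam ->]]]; rewrite -(sqnorm_orthonormal_cols UU).
apply: le_trans (sqnorm_opnorm_le _ Etau).
have GU : G *m U = U *m diag_mx d by rewrite -mulmxA UU mulmx1.
have := davis_kahan (proj1 Vlam) GU _ d_ge (fun j => weyl_upper (j := j) Etau Vlam).
by rewrite opprD addrA subrr sub0r mulNmx sqnormN; apply; move: tau0 gap; lra.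
Qed.

Lemma top_projection_dist_le E1 E2 Q1 Q2 : opnorm_le E1 tau -> opnorm_le E2 tau ->
  is_top_projection r (G + E1) Q1 -> is_top_projection r (G + E2) Q2 ->
  (sig - 2 * tau) ^+ 2 * sqnorm (Q1 - Q2) <= 2 * sqnorm ((E1 - E2) *m Q1).
Proof.
move=> Etau1 Etau2 [V1 [lam1 [Vlam1 ->]]] [V2 [lam2 [Vlam2 ->]]].
have [[VV1 _] _] := Vlam1; have [[VV2 _] _] := Vlam2; rewrite sqnorm_sub_topproj //.
have := davis_kahan_topproj rn (proj1 Vlam1) (proj1 Vlam2) _
  (fun j => weyl_lower (j := j) Etau1 Vlam1) (fun j => weyl_upper (j := j) Etau2 Vlam2).
have -> : G + E1 - (G + E2) = E1 - E2 by rewrite opprD addrACA subrr add0r.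
have -> : sig - tau - tau = sig - 2 * tau by ring.
by move=> bound; rewrite mulrCA ler_pM2l //; apply: bound; move: tau0 gap; lra.
Qed.

Lemma top_projection_unique E Q1 Q2 : opnorm_le E tau ->
  is_top_projection r (G + E) Q1 -> is_top_projection r (G + E) Q2 -> Q1 = Q2.
Proof.
move=> Etau topQ1 topQ2; have := top_projection_dist_le Etau Etau topQ1 topQ2.
rewrite subrr mul0mx sqnorm0 mulr0 pmulr_rle0 ?exprn_gt0 ?subr_gt0 // => dist_le0.
apply/eqP; rewrite -subr_eq0; apply/eqP/sqnorm_eq0/eqP.
by rewrite eq_le dist_le0 sqnorm_ge0.
Qed.

End LowRankPerturbation.

Section LargestRow.
Variable R : rcfType.

Definition rowmax a b (M : 'M[R]_(a, b)) : R := \big[Num.max/0]_i fnorm (row i M).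

Lemma rowmax_ge0 a b (M : 'M[R]_(a, b)) : 0 <= rowmax M.
Proof. by rewrite /rowmax; elim/big_rec: _ => // i x _ x0; rewrite le_max x0 orbT. Qed.

Lemma le_rowmax a b (M : 'M[R]_(a, b)) i : fnorm (row i M) <= rowmax M.
Proof. exact: (le_bigmax 0 (fun i => fnorm (row i M))). Qed.

Lemma rowmax_le a b (M : 'M[R]_(a, b)) t :
  0 <= t -> (forall i, fnorm (row i M) <= t) -> rowmax M <= t.
Proof. by move=> t0 row_le; exact: bigmax_le. Qed.

Lemma rowmax_sub_le a b (M N : 'M[R]_(a, b)) : rowmax M <= rowmax N + fnorm (M - N).
Proof.
apply: rowmax_le => [|i]; first by rewrite addr_ge0 ?rowmax_ge0 ?fnorm_ge0.
have -> : row i M = row i N + row i (M - N) by rewrite -raddfD /= addrC subrK.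
apply: le_trans (fnormD _ _) _; apply: lerD; first exact: le_rowmax.
exact: fnorm_row_le.
Qed.

Lemma single_support_rV a (u : 'rV[R]_a) :
  (forall i j, u 0 i != 0 -> u 0 j != 0 -> i = j) ->
  u = 0 \/ exists i, u = u 0 i *: delta_mx 0 i.
Proof.
move=> single; have [->|/rV0Pn[i ui]] := eqVneq u 0; [by left | right].
exists i; apply/rowP => j; rewrite !mxE eqxx /=.
have [<-|ji] := eqVneq j i; first by rewrite mulr1.
by rewrite mulr0; apply/eqP; apply: contra_neqT ji => uj; exact: single.
Qed.

Lemma sqnorm_delta_rV a (i : 'I_a) : sqnorm (delta_mx 0 i : 'rV[R]_a) = 1.
Proof. by rewrite sqnorm_trace trmx_delta mul_delta_mx trace_mx11 mxE. Qed.

Lemma sqnorm_single_support_mul_le a b (u : 'rV[R]_a) (M : 'M[R]_(a, b)) :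
  (forall i j, u 0 i != 0 -> u 0 j != 0 -> i = j) ->
  sqnorm (u *m M) <= sqnorm u * rowmax M ^+ 2.
Proof.
case/single_support_rV => [->|[i ->]]; first by rewrite mul0mx !sqnorm0 mul0r.
rewrite -scalemxAl -rowE !sqnormZ -mulrA; apply: ler_wpM2l; first exact: sqr_ge0.
rewrite sqnorm_delta_rV mul1r -fnorm_sq.
by rewrite ler_sqr ?nnegrE ?fnorm_ge0 ?rowmax_ge0 // le_rowmax.
Qed.

End LargestRow.

Section LeaveOneOut.
Variable R : rcfType.

Definition coord_compl n (i : 'I_n) : 'M[R]_n := 1%:M - delta_mx i i.

Lemma orthoproj_coord_compl n (i : 'I_n) : orthoproj (coord_compl i).
Proof. exact/orthoproj_compl/orthoproj_delta. Qed.

Lemma coord_complM n b (i a : 'I_n) (M : 'M[R]_(n, b)) c :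
  (coord_compl i *m M) a c = if a == i then 0 else M a c.
Proof.
rewrite mulmxBl mul1mx mxE [(- _ : 'M[R]_(n, b)) a c]mxE mxE (bigD1 i) //= big1 => [|l li].
  by rewrite mxE eqxx andbT addr0; case: eqP => [->|_]; rewrite ?mul1r ?subrr ?mul0r ?subr0.
by rewrite mxE (negPf li) andbF mul0r.
Qed.

Lemma fnorm_delta_mul n b (i : 'I_n) (M : 'M[R]_(n, b)) :
  fnorm (delta_mx i i *m M) = fnorm (row i M).
Proof.
rewrite /fnorm -(mul_delta_mx (0 : 'I_1)) -mulmxA -rowE sqnorm_isometry //.
rewrite /orthonormal_cols trmx_delta mul_delta_mx.
by apply/matrixP => a c; rewrite !mxE !ord1.
Qed.

Definition compress n (i : 'I_n) (E : 'M[R]_n) : 'M[R]_n := coord_compl i *m E *m coord_compl i.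

Lemma opnorm_le_compress n (i : 'I_n) (E : 'M[R]_n) t :
  opnorm_le E t -> opnorm_le (compress i E) t.
Proof.
have P_proj := orthoproj_coord_compl i; move=> Et x; rewrite /compress -!mulmxA.
apply: le_trans (sqnorm_orthoproj_mul _ P_proj) _; apply: le_trans (Et _) _.
by apply: ler_wpM2l; [exact: sqr_ge0|exact: sqnorm_orthoproj_mul].
Qed.

Lemma compressT n (i : 'I_n) (E : 'M[R]_n) : E^T = E -> (compress i E)^T = compress i E.
Proof.
by move=> ET; rewrite /compress !trmx_mul (proj1 (orthoproj_coord_compl i)) ET mulmxA.
Qed.

Lemma sub_compress n (i : 'I_n) (E : 'M[R]_n) :
  E - compress i E = delta_mx i i *m E + coord_compl i *m E *m delta_mx i i.
Proof.
rewrite /compress {2}/coord_compl mulmxBr mulmx1 opprB addrA addrAC.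
by rewrite {2}/coord_compl mulmxBl mul1mx subKr.
Qed.

Variables (n r : nat) (U : 'M[R]_(n, r)) (d : 'rV[R]_r) (E Q : 'M[R]_n) (sig tau g : R).
Variable Q_ : 'I_n -> 'M[R]_n.
Local Notation G := (U *m diag_mx d *m U^T).
Hypotheses (rn : (r <= n)%N) (UU : orthonormal_cols U) (d_ge : forall c, sig <= d 0 c).
Hypotheses (sig0 : 0 < sig) (tau0 : 0 <= tau) (tau_le : tau <= sig / 20).
Hypotheses (Etau : opnorm_le E tau) (topQ : is_top_projection r (G + E) Q).
Hypothesis topQ_ : forall i, is_top_projection r (G + compress i E) (Q_ i).
Hypothesis row_noise_loo : forall i, fnorm (row i (E *m Q_ i)) <= sig / 20 * rowmax (Q_ i).
Hypotheses (g0 : 0 <= g) (rowG : forall i, fnorm (row i G) <= g).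

Let gap : 2 * tau < sig. Proof. by move: sig0 tau_le; lra. Qed.

Lemma loo_noise_sub_le i : fnorm ((E - compress i E) *m Q_ i) <= sig / 10 * rowmax (Q_ i).
Proof.
rewrite sub_compress mulmxDl; apply: le_trans (fnormD _ _) _.
have row_le : fnorm (delta_mx i i *m E *m Q_ i) <= sig / 20 * rowmax (Q_ i).
  by rewrite -mulmxA fnorm_delta_mul.
have col_le : fnorm (coord_compl i *m E *m delta_mx i i *m Q_ i) <= tau * rowmax (Q_ i).
  rewrite -!mulmxA; apply: (@le_trans _ _ (fnorm (E *m (delta_mx i i *m Q_ i)))).
    by rewrite fnorm_le_fnorm; apply/sqnorm_orthoproj_mul/orthoproj_coord_compl.
  apply: le_trans (fnorm_opnorm_le _ tau0 Etau) _.
  by rewrite fnorm_delta_mul; apply: ler_wpM2l => //; exact: le_rowmax.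
have := ler_wpM2r (rowmax_ge0 (Q_ i)) tau_le.
by lra.
Qed.

Lemma loo_dist_le i : fnorm (Q_ i - Q) <= rowmax (Q_ i) / 6.
Proof.
have M0 := rowmax_ge0 (Q_ i).
have := top_projection_dist_le rn UU d_ge tau0 gap (opnorm_le_compress i Etau) Etau (topQ_ i) topQ.
have : sqnorm ((compress i E - E) *m Q_ i) <= (sig / 10 * rowmax (Q_ i)) ^+ 2.
  rewrite -opprB mulNmx sqnormN -fnorm_le; last by rewrite mulr_ge0 // ltW // divr_gt0.
  exact: loo_noise_sub_le.
have gap_ge : (9 / 10 * sig) ^+ 2 <= (sig - 2 * tau) ^+ 2.
  by move: sig0 tau_le => ? ?; rewrite ler_sqr ?nnegrE; lra.
have := ler_wpM2r (sqnorm_ge0 (Q_ i - Q)) gap_ge.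
rewrite fnorm_le; last by rewrite divr_ge0.
rewrite !exprMn => gap_le noise_le dist_le.
have : sig ^+ 2 * (81 / 100 * sqnorm (Q_ i - Q)) <= sig ^+ 2 * (2 / 100 * rowmax (Q_ i) ^+ 2).
  by lra.
by rewrite ler_pM2l ?exprn_gt0 //; have := sqr_ge0 (rowmax (Q_ i)); lra.
Qed.

Lemma row_noise_le i : fnorm (row i (E *m Q)) <= 7 / 100 * sig * rowmax Q.
Proof.
have -> : row i (E *m Q) = row i (E *m Q_ i) - row i (E *m (Q_ i - Q)).
  by rewrite -raddfB /= -mulmxBr subKr.
apply: le_trans (fnormB _ _) _; have loo_le := row_noise_loo i.
have dist_le : fnorm (row i (E *m (Q_ i - Q))) <= sig / 20 * fnorm (Q_ i - Q).
  apply: le_trans (fnorm_row_le _ i) _; apply: le_trans (fnorm_opnorm_le _ tau0 Etau) _.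
  by apply: ler_wpM2r tau_le; exact: fnorm_ge0.
have max_le := rowmax_sub_le (Q_ i) Q; have dist6 := loo_dist_le i.
have : sig / 20 * (rowmax (Q_ i) + fnorm (Q_ i - Q)) <= sig / 20 * (7 / 5 * rowmax Q).
  by apply: ler_wpM2l; move: sig0; lra.
by lra.
Qed.

Lemma leave_one_out i : fnorm (row i Q) <= 2 * g / sig.
Proof.
have sig_gt0 := sig0; have small := tau_le.
have row_le j : (sig - tau) * fnorm (row j Q) <= g + 7 / 100 * sig * rowmax Q.
  have := top_projection_lower rn UU d_ge tau0 gap (delta_mx j j) Etau topQ.
  rewrite !fnorm_delta_mul => /le_trans-> //.
  have -> : row j ((G + E) *m Q) = row j G *m Q + row j (E *m Q).
    by rewrite mulmxDl raddfD /= row_mul.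
  apply: le_trans (fnormD _ _) _; apply: lerD; last exact: row_noise_le.
  apply: le_trans (rowG j); rewrite fnorm_le_fnorm; apply: sqnorm_mul_orthoproj.
  exact: is_top_projection_orthoproj topQ.
have max_le : (19 / 20 * sig) * rowmax Q <= g + 7 / 100 * sig * rowmax Q.
  rewrite mulrC -ler_pdivlMr; last by lra.
  apply: rowmax_le => [|j].
    have : 0 <= sig * rowmax Q by rewrite mulr_ge0 ?rowmax_ge0 // ltW.
    by move=> sM; apply: divr_ge0; move: g0; lra.
  rewrite ler_pdivlMr; last by lra.
  rewrite mulrC; apply: le_trans (row_le j); apply: ler_wpM2r; [exact: fnorm_ge0|lra].
apply: le_trans (le_rowmax _ i) _; rewrite ler_pdivlMr // mulrC.
by have : 0 <= sig * rowmax Q; [rewrite mulr_ge0 ?rowmax_ge0 // ltW|lra].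
Qed.

End LeaveOneOut.

Lemma sum_enum_rank (V : nmodType) (X : finType) (F : 'I_#|X| -> V) :
  \sum_c F c = \sum_x F (enum_rank x).
Proof. by rewrite (reindex _ (onW_bij _ (enum_rank_bij X))). Qed.

Section KroneckerProduct.
Variables (R : comNzRingType) (k n : nat).
Local Notation N := #|{: mindex k n}|.
Local Notation midx c := (enum_val c : mindex k n).
Implicit Types (P Q : 'I_k -> 'M[R]_n) (X : mindex k n -> R).

Definition tvec X : 'cV[R]_N := \col_c X (enum_val c).

Definition kron P : 'M[R]_N :=
  \matrix_(c, c') \prod_l P l (midx c l) (midx c' l).

Lemma eq_tvec X X' : X =1 X' -> tvec X = tvec X'.
Proof. by move=> XX'; apply/matrixP => c o; rewrite !mxE. Qed.

Lemma eq_kron P Q : P =1 Q -> kron P = kron Q.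
Proof. by move=> PQ; congr kron; apply/funext. Qed.

Lemma kron_mul P Q : kron P *m kron Q = kron (fun l => P l *m Q l).
Proof.
apply/matrixP => a b; rewrite !mxE.
rewrite (eq_bigr (fun l => \sum_i P l (midx a l) i * Q l i (midx b l))); last first.
  by move=> l _; rewrite mxE.
rewrite (bigA_distr_bigA (fun l i => P l (midx a l) i * Q l i (midx b l))).
rewrite sum_enum_rank; apply: eq_bigr => f _.
by rewrite !mxE -big_split enum_rankK.
Qed.

Lemma kronT P : (kron P)^T = kron (fun l => (P l)^T).
Proof. by apply/matrixP => a b; rewrite !mxE; apply: eq_bigr => l _; rewrite mxE. Qed.

Lemma kron1 : kron (fun=> 1%:M) = 1%:M.
Proof.
apply/matrixP => a b; rewrite !mxE; case: eqP => [->|/eqP ab].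
  by rewrite big1 // => l _; rewrite mxE eqxx.
have [l fl] : exists l, midx a l != midx b l.
  apply/existsP; rewrite -negb_forall; apply: contra ab => /forallP eq_ab.
  by apply/eqP/enum_val_inj/ffunP => l; exact/eqP.
by rewrite (bigD1 l) //= mxE (negPf fl) mul0r.
Qed.

End KroneckerProduct.

Section KroneckerNorms.
Variables (R : rcfType) (k n : nat).
Implicit Types (P : 'I_k -> 'M[R]_n) (X : mindex k n -> R).

Lemma orthoproj_kron P : (forall l, orthoproj (P l)) -> orthoproj (kron P).
Proof.
move=> Pproj; split; first by rewrite kronT; apply: eq_kron => l; case: (Pproj l).
by rewrite kron_mul; apply: eq_kron => l; case: (Pproj l).
Qed.

Lemma sqnorm_kron_col P c :
  sqnorm (col c (kron P)) = \prod_l sqnorm (col ((enum_val c : mindex k n) l) (P l)).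
Proof.
have colE m p (M : 'M[R]_(m, p)) j : sqnorm (col j M) = (M^T *m M) j j.
  by rewrite sqnormE mxE; apply: eq_bigr => i _; rewrite big_ord1 !mxE expr2.
by rewrite colE kronT kron_mul mxE; apply: eq_bigr => l _; rewrite colE.
Qed.

Definition slot (j : 'I_k) (A : 'M[R]_n) (l : 'I_k) : 'M[R]_n := if l == j then A else 1%:M.

Lemma kron_slotE j (A : 'M[R]_n) a b (f := enum_val a : mindex k n)
    (g := enum_val b : mindex k n) :
  kron (slot j A) a b = A (f j) (g j) * \prod_(l | l != j) (1%:M : 'M[R]_n) (f l) (g l).
Proof.
rewrite mxE (bigD1 j) //= /slot eqxx; congr (_ * _).
by apply: eq_bigr => l /negPf->.
Qed.

Lemma kron_slotB j (A B : 'M[R]_n) :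
  kron (slot j (A - B)) = kron (slot j A) - kron (slot j B).
Proof.
have subE m p (M N : 'M[R]_(m, p)) a b : (M - N) a b = M a b - N a b by rewrite !mxE.
by apply/matrixP => a b; rewrite subE !kron_slotE subE mulrBl.
Qed.

Lemma kron_slot1 j : kron (slot j 1%:M) = 1%:M.
Proof. by rewrite -kron1; apply: eq_kron => l; rewrite /slot; case: ifP. Qed.

(* [1 - Q (x) ... (x) Q] telescopes over the modes. *)
Lemma kron_bias (Q : 'M[R]_n) X t : orthoproj Q ->
  (forall j, fnorm (kron (slot j (1%:M - Q)) *m tvec X) <= t) ->
  fnorm (tvec X - kron (fun=> Q) *m tvec X) <= k%:R * t.
Proof.
move=> Qproj bias_le; have [_ QQ] := Qproj.
pose K m := kron (fun l : 'I_k => if (l < m)%N then Q else 1%:M).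
suff partial_bias m : (m <= k)%N -> fnorm (tvec X - K m *m tvec X) <= m%:R * t.
  rewrite (_ : kron _ = K k); first exact: partial_bias.
  by apply: eq_kron => l; rewrite ltn_ord.
elim: m => [_|m IH mk].
  rewrite (_ : K 0%N = 1%:M) ?mul1mx ?subrr ?mul0r; last by rewrite -kron1; exact: eq_kron.
  by rewrite fnorm0.
pose j : 'I_k := Ordinal mk.
have KS : K m.+1 = K m *m kron (slot j Q).
  rewrite kron_mul; apply: eq_kron => l; rewrite /slot -val_eqE /= ltnS leq_eqVlt.
  by case: ltngtP => //=; rewrite ?mulmx1 ?mul1mx.
have -> : tvec X - K m.+1 *m tvec X =
   (tvec X - K m *m tvec X) + K m *m (kron (slot j (1%:M - Q)) *m tvec X).
  by rewrite KS kron_slotB kron_slot1 mulmxBl mul1mx mulmxBr !mulmxA addrA subrK.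
apply: le_trans (fnormD _ _) _; rewrite -natr1 mulrDl mul1r; apply: lerD.
  exact: IH (ltnW mk).
apply: le_trans (bias_le j); rewrite fnorm_le_fnorm; apply/sqnorm_orthoproj_mul/orthoproj_kron.
by move=> l; case: ifP => // _; split; rewrite ?trmx1 ?mulmx1.
Qed.

End KroneckerNorms.

Section Unfolding.
Variables (R : realType) (k n : nat).
Implicit Types (T : mindex k n -> R) (j : 'I_k) (M : 'M[R]_(n, ncol k n)).

Lemma frob_tvec T : frob T = fnorm (tvec T).
Proof.
rewrite /frob /fnorm sqnormE sum_enum_rank; congr Num.sqrt.
by apply: eq_bigr => f _; rewrite big_ord1 mxE enum_rankK.
Qed.

Lemma insert_at_bij j :
  bijective (fun ic : 'I_n * 'I_(ncol k n) => insert_at j ic.1 (enum_val ic.2)).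
Proof.
exists (fun f : mindex k n => (f j, enum_rank (drop_at j f))) => [[i c]|f].
  congr pair; first by rewrite ffunE unlift_none.
  by rewrite -[RHS]enum_valK; congr enum_rank; apply/ffunP => l; rewrite !ffunE liftK.
apply/ffunP => l; rewrite enum_rankK !ffunE /=.
by case: unliftP => [l' ->|->] //; rewrite ffunE.
Qed.

Lemma sum_insert_at j (F : mindex k n -> R) :
  \sum_f F f = \sum_i \sum_(c < ncol k n) F (insert_at j i (enum_val c)).
Proof. by rewrite (reindex _ (onW_bij _ (insert_at_bij j))) pair_bigA. Qed.

Lemma unfoldK j T : fold j (unfold j T) =1 T.
Proof.
move=> f; rewrite /fold mxE enum_rankK; congr T; apply/ffunP => l; rewrite ffunE.
by case: unliftP => [l' ->|->] //; rewrite ffunE.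
Qed.

Lemma sqnorm_tvec_fold j M : sqnorm (tvec (fold j M)) = sqnorm M.
Proof.
rewrite !sqnormE sum_enum_rank (sum_insert_at j); apply: eq_bigr => i _; apply: eq_bigr => c _.
rewrite big_ord1 mxE enum_rankK /fold; congr (M _ _ ^+ 2); first by rewrite ffunE unlift_none.
by rewrite -[RHS]enum_valK; congr enum_rank; apply/ffunP => l; rewrite !ffunE liftK.
Qed.

Lemma fnorm_unfold j T : fnorm (unfold j T) = frob T.
Proof. by rewrite frob_tvec -(eq_tvec (unfoldK j T)) /fnorm sqnorm_tvec_fold. Qed.

Lemma kron_tvec (P : 'I_k -> 'M[R]_n) j T :
  kron P *m tvec T =
  tvec (fold j (P j *m unfold j T *m (kron (fun l : 'I_k.-1 => P (lift j l)))^T)).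
Proof.
apply/matrixP => a o; rewrite [RHS]mxE /fold mxE sum_enum_rank (sum_insert_at j).
rewrite exchange_big mxE; apply: eq_bigr => c _.
rewrite !mxE mulr_suml; apply: eq_bigr => i _; rewrite !mxE !enum_rankK (bigD1_ord j) //=.
rewrite !ffunE !unlift_none -[LHS]mulrA -[RHS]mulrA [_ * T _]mulrC; congr (_ * (_ * _)).
by apply: eq_bigr => l _; rewrite !ffunE liftK.
Qed.

Lemma sqnorm_kron_slot T j (A : 'M[R]_n) :
  sqnorm (kron (slot j A) *m tvec T) = sqnorm (A *m unfold j T).
Proof.
rewrite (kron_tvec _ j) sqnorm_tvec_fold {1}/slot eqxx.
rewrite (_ : kron _ = 1%:M) ?trmx1 ?mulmx1 // -kron1; apply: eq_kron => l.
by rewrite /slot eq_sym (negPf (neq_lift j l)).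
Qed.

Lemma unfold_symmetric T j j' : symmetric_tensor T -> unfold j T = unfold j' T.
Proof.
case: k j j' T => [[]//|k'] j j' T Tsym; apply/matrixP => i c; rewrite !mxE.
rewrite -[RHS](Tsym (lift_perm j j' 1)); congr T; apply/ffunP => l; rewrite !ffunE.
case: (unliftP j l) => [l' ->|->].
  by rewrite lift_perm_lift perm1 liftK.
by rewrite lift_perm_id unlift_none.
Qed.

Lemma tensor_bias_le j m T (Q : 'M[R]_n) (U : 'M[R]_(n, m)) : symmetric_tensor T ->
  orthoproj Q -> orthonormal_cols U -> U *m U^T *m unfold j T = unfold j T ->
  fnorm (tvec T - kron (fun=> Q) *m tvec T) <= k%:R * (fnorm ((1%:M - Q) *m U) * frob T).
Proof.
move=> Tsym Qproj UU UT; apply: kron_bias => // j'.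
rewrite /fnorm sqnorm_kron_slot (unfold_symmetric j' j Tsym) -/(fnorm _).
rewrite -UT -(mulmxA U) mulmxA; apply: le_trans (fnormM _ _) _.
apply: ler_wpM2l; first exact: fnorm_ge0.
rewrite -(fnorm_unfold j T) fnorm_le_fnorm -(sqnorm_isometry _ UU) mulmxA UT.
exact: lexx.
Qed.

End Unfolding.

Section EntrySampling.
Variables (R : realType) (k n : nat).
Implicit Types (T : mindex k n -> R) (e : esample k n) (q : R).

Definition rescaled_sample T q e : mindex k n -> R := fun f => q^-1 * (if e f then T f else 0).

Lemma estimator_tvec r (hk : (1 < k)%N) T q (U : 'M[R]_(n, r)) e :
  tvec (estimator hk T q U e) = kron (fun=> U *m U^T) *m tvec (rescaled_sample T q e).
Proof.
have QT : (U *m U^T)^T = U *m U^T by rewrite trmx_mul trmxK.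
rewrite (kron_tvec _ (mode1 hk)) kronT /estimator /rescaled_sample.
congr (tvec (fold _ (_ *m _))); apply/matrixP => a b; rewrite !mxE.
by apply: eq_bigr => l _; rewrite QT.
Qed.

Lemma estimator_error_le r (hk : (1 < k)%N) T q (U : 'M[R]_(n, r)) e
    (K := kron (fun _ : 'I_k => U *m U^T)) :
  frob (fun f => T f - estimator hk T q U e f) <=
  fnorm (tvec T - K *m tvec T) + fnorm (K *m tvec T - K *m tvec (rescaled_sample T q e)).
Proof.
rewrite -estimator_tvec frob_tvec; apply: le_trans (fnormD _ _); rewrite addrA subrK.
rewrite (_ : tvec _ = tvec T - tvec (estimator hk T q U e)) //.
by apply/matrixP => c o; rewrite !mxE.
Qed.

Lemma sampling_noise_lincomb m (K : 'M[R]_(m, #|{: mindex k n}|)) T q e :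
  K *m tvec T - K *m tvec (rescaled_sample T q e) =
  - lincomb (fun f => T f *: col (enum_rank f) K) (centered q e).
Proof.
rewrite -mulmxBr /lincomb -sumrN; apply/matrixP => a o.
rewrite mxE summxE sum_enum_rank; apply: eq_bigr => f _; rewrite !mxE enum_rankK.
by rewrite /rescaled_sample /centered; case: (e f) => /=; ring.
Qed.

Lemma sampling_noise_tail T (Q : 'M[R]_n) (h b q : R) s :
  (0 < s)%N -> 0 < q <= 1 -> 0 <= h -> 0 <= b -> Q^T = Q ->
  (forall i, fnorm (row i Q) <= b) -> (forall f, T f ^+ 2 <= h) ->
  s%:R <= 3 * (q * n%:R ^+ k) ->
  prob q (fun e => tail_level s (3 * n%:R ^+ k * (h * (b ^+ 2) ^+ k) / q) <
    sqnorm (kron (fun=> Q) *m tvec T - kron (fun=> Q) *m tvec (rescaled_sample T q e)))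
  <= expR (- s%:R).
Proof.
move=> s0 q01 h0 b0 QT Qb Th s_le; have /andP[q0 _] := q01.
have q01W := gt0_le1W q01.
pose H f := T f *: col (enum_rank f) (kron (fun _ : 'I_k => Q)).
set hb := h * (b ^+ 2) ^+ k; have hb0 : 0 <= hb by rewrite /hb; nonneg.
have H_le f : sqnorm (H f) <= hb.
  rewrite sqnormZ sqnorm_kron_col; apply: ler_pM => //; first exact: sqr_ge0.
    by apply: prodr_ge0 => l _; exact: sqnorm_ge0.
  have -> : (b ^+ 2) ^+ k = \prod_(l < k) b ^+ 2 by rewrite prodr_const card_ord.
  apply: ler_prod => l _; rewrite sqnorm_ge0 /= -sqnormT tr_col QT -fnorm_sq.
  by rewrite ler_sqr ?nnegrE ?fnorm_ge0.
have proxy : variance_proxy q s (fun f => sqnorm (H f)) (3 * n%:R ^+ k * hb / q).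
  split=> [|f].
    rewrite ler_pM2r ?invr_gt0 //; apply: le_trans (ler_sum _ (fun f _ => H_le f)) _.
    rewrite sumr_const card_ffun !card_ord -[_ *+ _]mulr_natl natrX.
    by have : 0 <= n%:R ^+ k * hb; [nonneg|lra].
  apply: le_trans (_ : s%:R * (hb / q ^+ 2) <= _).
    by apply: ler_wpM2l; [exact: ler0n|rewrite ler_pM2r ?invr_gt0 ?exprn_gt0].
  have -> : 3 * n%:R ^+ k * hb / q = 3 * (q * n%:R ^+ k) * (hb / q ^+ 2).
    by field; exact: lt0r_neq0.
  by apply: ler_wpM2r s_le; nonneg.
apply: le_trans (vector_tail s0 q01 _ proxy); last by nonneg.
by apply: prob_le => // e; rewrite sampling_noise_lincomb sqnormN.
Qed.

End EntrySampling.

Section Wedges.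
Variables (R : realType) (n m : nat) (A : 'M[R]_(n, m)).
Local Notation triple := ('I_n * 'I_m * 'I_n)%type.
Local Notation omin a b := (Order.min a b : 'I_n).
Local Notation omax a b := (Order.max a b : 'I_n).

(* A triple [(i, l, j)] with [i <= j] contributes to both entries [(i, j)] and [(j, i)],
   the other triples to none. *)
Definition wedge_mx (x : triple) : 'M[R]_n :=
  \matrix_(a, b) (if (x.1.1 == omin a b) && (x.2 == omax a b)
                  then A a x.1.2 * A b x.1.2 else 0).

Lemma min_max_inj (a b c : 'I_n) : omin a c = omin b c -> omax a c = omax b c -> a = b.
Proof. by case: (leP a c) => ?; case: (leP b c) => ? // *; subst. Qed.

Lemma min_max_or (a b : 'I_n) :
  omin a b = a /\ omax a b = b \/ omin a b = b /\ omax a b = a.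
Proof. by case: leP => _; [left|right]. Qed.

Lemma wedge_mxT x : (wedge_mx x)^T = wedge_mx x.
Proof.
by apply/matrixP => a b; rewrite !mxE minC maxC; case: ifP => // _; rewrite mulrC.
Qed.

Lemma wedge_mx_single_support x a b b' :
  wedge_mx x a b != 0 -> wedge_mx x a b' != 0 -> b = b'.
Proof.
rewrite !mxE; case: ifP => [/andP[/eqP min_b /eqP max_b] _|]; last by rewrite eqxx.
case: ifP => [/andP[/eqP min_b' /eqP max_b'] _|]; last by rewrite eqxx.
apply: (@min_max_inj _ _ a); first by rewrite minC -min_b min_b' minC.
by rewrite maxC -max_b max_b' maxC.
Qed.

Lemma row_wedge_mx_single_support x a i j :
  row a (wedge_mx x) 0 i != 0 -> row a (wedge_mx x) 0 j != 0 -> i = j.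
Proof. by rewrite ![row _ _ _ _]mxE; exact: wedge_mx_single_support. Qed.

Lemma wedge_mx_sq_diag x : is_diag_mx (wedge_mx x *m wedge_mx x).
Proof.
apply/is_diag_mxP => a b ab; rewrite mxE big1 // => c _.
apply/eqP; rewrite mulf_eq0; apply/norP => -[wac wcb]; case/negP: ab; apply/eqP; congr val.
by apply: (wedge_mx_single_support (x := x) (a := c)) => //; rewrite -wedge_mxT mxE.
Qed.

Lemma sum_triple_at (V : nmodType) (i j : 'I_n) (F : triple -> V) :
  \sum_x (if (x.1.1 == i) && (x.2 == j) then F x else 0) = \sum_l F (i, l, j).
Proof.
rewrite -big_mkcond (reindex (fun l => (i, l, j))) /=; last first.
  exists (fun x => x.1.2) => // -[[i' l] j'] /andP[/= /eqP-> /eqP->] //.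
by apply: eq_bigl => l; rewrite !eqxx.
Qed.

Lemma lincomb_wedge_mxE (c : triple -> R) a b :
  lincomb wedge_mx c a b = \sum_l c (omin a b, l, omax a b) * (A a l * A b l).
Proof.
rewrite summxE -(sum_triple_at _ _ (fun x => c x * (A a x.1.2 * A b x.1.2))).
by apply: eq_bigr => x _; rewrite !mxE; case: ifP; rewrite ?mulr0.
Qed.

Lemma sum_pairs_at (P : rel 'I_n) (t : 'I_n -> 'I_n -> R) a b :
  \sum_i \sum_(j | P i j) t i j * ((a == i) && (b == j))%:R = if P a b then t a b else 0.
Proof.
rewrite (bigD1 a) //= [X in _ + X]big1 ?addr0 => [|i /negPf ia]; last first.
  by apply: big1 => j _; rewrite eq_sym ia mulr0.
rewrite big_mkcond (bigD1 b) //= big1 ?addr0 => [|j /negPf jb]; last first.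
  by rewrite [b == j]eq_sym jb andbF mulr0 if_same.
by rewrite !eqxx mulr1.
Qed.

Lemma wedge_matrix_lincomb (p : R) (w : wsample n m) :
  wedge_matrix p A w = lincomb wedge_mx (fun x => (w x)%:R / p).
Proof.
apply/matrixP => a b; rewrite lincomb_wedge_mxE mxE.
pose t i j := \sum_l p^-1 * A i l * A j l * (w (i, l, j))%:R.
have -> : (\sum_(i < n) \sum_(j < n | (i < j)%N) \sum_(l < m)
      (wedge_term p A w i l j + (wedge_term p A w i l j)^T)) a b =
   (if (a < b)%N then t a b else 0) + (if (b < a)%N then t b a else 0).
  rewrite -(sum_pairs_at (fun i j => (i < j)%N) t a b).
  rewrite -(sum_pairs_at (fun i j => (i < j)%N) t b a) -big_split summxE.
  apply: eq_bigr => i _; rewrite summxE -big_split; apply: eq_bigr => j _.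
  rewrite summxE /= /t !mulr_suml -big_split; apply: eq_bigr => l _.
  by rewrite !mxE.
have -> : (\sum_(i < n) \sum_(l < m) wedge_term p A w i l i) a b =
    if a == b then t a b else 0.
  rewrite -(sum_pairs_at (fun i j => i == j) t a b) summxE; apply: eq_bigr => i _.
  rewrite (big_pred1 i) => [|j]; last by rewrite eq_sym.
  by rewrite summxE /t mulr_suml; apply: eq_bigr => l _; rewrite !mxE.
rewrite -val_eqE /Order.min /Order.max ltEord /=.
case: (ltngtP a b) => [_|_|/val_inj->]; rewrite ?addr0 ?add0r; apply: eq_bigr => l _; ring.
Qed.

Definition wedge_noise (p : R) (w : wsample n m) : 'M[R]_n :=
  lincomb wedge_mx (centered p w).

Lemma gram_wedge_mx : A *m A^T = lincomb wedge_mx (fun=> 1).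
Proof.
apply/matrixP => a b; rewrite lincomb_wedge_mxE mxE; apply: eq_bigr => l _.
by rewrite mxE mul1r.
Qed.

Lemma wedge_matrixE p w : wedge_matrix p A w = A *m A^T + wedge_noise p w.
Proof.
rewrite gram_wedge_mx wedge_matrix_lincomb /wedge_noise /lincomb -big_split.
by apply: eq_bigr => x _; rewrite /= -scalerDl addrC subrK.
Qed.

Lemma wedge_noiseT p w : (wedge_noise p w)^T = wedge_noise p w.
Proof. by apply: lincomb_sym; exact: wedge_mxT. Qed.

Lemma wedge_matrixT p w : (wedge_matrix p A w)^T = wedge_matrix p A w.
Proof. by rewrite wedge_matrixE linearD /= trmx_mul trmxK wedge_noiseT. Qed.

Lemma sum_sqnorm_row_wedge_mx_le a :
  \sum_x sqnorm (row a (wedge_mx x)) <= \sum_b \sum_l (A a l * A b l) ^+ 2.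
Proof.
under eq_bigr => x _ do rewrite sqnorm_rV.
rewrite exchange_big; apply: ler_sum => b _.
rewrite -(sum_triple_at (omin a b) (omax a b) (fun x => (A a x.1.2 * A b x.1.2) ^+ 2)).
by apply: ler_sum => x _; rewrite !mxE; case: ifP => // _; rewrite expr0n.
Qed.

Lemma sqnorm_row_wedge_mx_le h x a : (forall a b l, (A a l * A b l) ^+ 2 <= h ^+ 2) ->
  sqnorm (row a (wedge_mx x)) <= h ^+ 2.
Proof.
move=> entry_le.
have [->|[i ->]] := single_support_rV (@row_wedge_mx_single_support x a).
  by rewrite sqnorm0 sqr_ge0.
rewrite sqnormZ sqnorm_delta_rV mulr1 !mxE; case: ifP => // _.
by rewrite expr0n sqr_ge0.
Qed.

Definition touches (i : 'I_n) : pred triple := fun x => (x.1.1 == i) || (x.2 == i).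

Lemma wedge_mx_row_touches i x b : ~~ touches i x -> wedge_mx x i b = 0.
Proof.
rewrite /touches negb_or => /andP[x1 x2]; rewrite mxE; case: ifP => // /andP[/eqP min_x /eqP max_x].
by case: (min_max_or i b) x1 x2 => -[minE maxE]; rewrite min_x max_x minE maxE eqxx // andbF.
Qed.

Lemma compress_wedge_mx i x : touches i x -> compress i (wedge_mx x) = 0.
Proof.
move=> x_touches; apply/matrixP => a b; rewrite /compress -mulmxA coord_complM.
rewrite -[wedge_mx x *m _]trmxK trmx_mul (proj1 (orthoproj_coord_compl R i)) mxE coord_complM.
rewrite wedge_mxT !mxE; case: eqP => // /eqP ai; case: eqP => // /eqP bi.
case: ifP => // /andP[/eqP x1 /eqP x2]; move: x_touches; rewrite /touches x1 x2.
by case: (min_max_or b a) => -[-> ->]; rewrite (negPf ai) (negPf bi).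
Qed.

Lemma compress_wedge_noise_splice p i (w w' : wsample n m) :
  compress i (wedge_noise p (splice (touches i) w w')) = compress i (wedge_noise p w').
Proof.
rewrite /compress /wedge_noise /lincomb !mulmx_sumr !mulmx_suml; apply: eq_bigr => x _.
rewrite -!scalemxAr -!scalemxAl -/(compress i _) /centered ffunE.
by case: ifP => // /compress_wedge_mx->; rewrite !scaler0.
Qed.

Lemma row_wedge_noise_splice p i (w w' : wsample n m) :
  row i (wedge_noise p (splice (touches i) w w')) = row i (wedge_noise p w).
Proof.
apply/rowP => b; rewrite !mxE !summxE; apply: eq_bigr => x _; rewrite [LHS]mxE [RHS]mxE.
by rewrite /centered ffunE; case: ifP => // /negbT/wedge_mx_row_touches->; rewrite !mulr0.
Qed.

Lemma row_wedge_noise_mul p i w b (M : 'M[R]_(n, b)) :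
  row i (wedge_noise p w) *m M = lincomb (fun x => row i (wedge_mx x) *m M) (centered p w).
Proof.
rewrite /wedge_noise /lincomb linear_sum mulmx_suml; apply: eq_bigr => x _.
by rewrite linearZ /= scalemxAl.
Qed.

End Wedges.

Section CompactSVD.
Variable R : realType.

Lemma row_norm2E a b (M : 'M[R]_(a, b)) i : row_norm2 M i = sqnorm (row i M).
Proof. by rewrite sqnorm_rV; apply: eq_bigr => j _; rewrite mxE. Qed.

Lemma row_norm2_gram a r (U : 'M[R]_(a, r)) i : row_norm2 U i = (U *m U^T) i i.
Proof. by rewrite mxE; apply: eq_bigr => c _; rewrite mxE expr2. Qed.

Lemma compact_svd_tr a b r (M : 'M[R]_(a, b)) U (s : 'rV[R]_r) V :
  compact_svd M U s V -> compact_svd M^T V s U.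
Proof.
move=> [UU VV s0 s_sorted ->]; split => //.
by rewrite !trmx_mul trmxK tr_diag_mx mulmxA.
Qed.

Lemma compact_svd_gram a b r (M : 'M[R]_(a, b)) U (s : 'rV[R]_r) V :
  compact_svd M U s V -> M *m M^T = U *m diag_mx (\row_c s 0 c ^+ 2) *m U^T.
Proof.
move=> [_ VV _ _ ->]; rewrite !trmx_mul trmxK tr_diag_mx !mulmxA -(mulmxA _ V^T V) VV mulmx1.
by rewrite -(mulmxA U) mulmx_diag.
Qed.

Lemma compact_svd_absorb a b r (M : 'M[R]_(a, b)) U (s : 'rV[R]_r) V :
  compact_svd M U s V -> U *m U^T *m M = M.
Proof. by move=> [UU _ _ _ ->]; rewrite !mulmxA -(mulmxA U) UU mulmx1. Qed.

Lemma compact_svd_left_absorb a b r r' (M : 'M[R]_(a, b))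
    U (s : 'rV[R]_r) V U' (s' : 'rV[R]_r') V' :
  compact_svd M U s V -> compact_svd M U' s' V' -> U *m U^T *m U' = U'.
Proof.
move=> /compact_svd_absorb UM [_ VV' s'0 _ ME'].
suff U'E : U' = M *m V' *m diag_mx (\row_i (s' 0 i)^-1) by rewrite {1}U'E !mulmxA UM -U'E.
rewrite ME' -(mulmxA _ V'^T) VV' mulmx1 -mulmxA mulmx_diag.
rewrite (_ : \row_j _ = const_mx 1) ?diag_const_mx ?mulmx1 //.
by apply/rowP => i; rewrite !mxE mulfV // lt0r_neq0.
Qed.

Lemma compact_svd_left_gram_uniq a b r r' (M : 'M[R]_(a, b))
    U (s : 'rV[R]_r) V U' (s' : 'rV[R]_r') V' :
  compact_svd M U s V -> compact_svd M U' s' V' -> U *m U^T = U' *m U'^T.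
Proof.
move=> svd svd'; have UU' := compact_svd_left_absorb svd svd'.
have : (U' *m U'^T *m U *m U^T)^T = (U *m U^T)^T by rewrite (compact_svd_left_absorb svd' svd).
by rewrite !trmx_mul !trmxK !mulmxA UU' => ->.
Qed.

Section Bounds.
Variables (a b r : nat) (M : 'M[R]_(a, b)).
Variables (U : 'M[R]_(a, r)) (s : 'rV[R]_r) (V : 'M[R]_(b, r)) (S : R).
Hypotheses (svd : compact_svd M U s V) (s_le : forall c, s 0 c <= S).

Lemma singular_value_sq_le c : s 0 c ^+ 2 <= S ^+ 2.
Proof. by case: svd => _ _ s0 _ _; rewrite lerXn2r ?nnegrE // ltW // (lt_le_trans (s0 c)). Qed.

Lemma sqnorm_row_svd_le i : sqnorm (row i M) <= S ^+ 2 * sqnorm (row i U).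
Proof.
case: svd => _ VV _ _ ->; rewrite row_mul sqnorm_mul_trmx_isometry // row_mul.
by apply: sqnorm_mul_diag_le; exact: singular_value_sq_le.
Qed.

Lemma entry_svd_le i l : M i l ^+ 2 <= S ^+ 2 * sqnorm (row i U) * sqnorm (row l V).
Proof.
have -> : M i l = fdot (row i U *m diag_mx s) (row l V).
  case: svd => _ _ _ _ ->; rewrite /fdot big_ord1 mxE.
  by apply: eq_bigr => c _; rewrite -row_mul !mxE.
apply: le_trans (fdot_cauchy_schwarz _ _) _; apply: ler_wpM2r; first exact: sqnorm_ge0.
by apply: sqnorm_mul_diag_le; exact: singular_value_sq_le.
Qed.

Lemma singular_value_le_fnorm c : s 0 c <= fnorm M.
Proof.
case: svd => UU VV s0 _ ->; rewrite -ler_sqr ?nnegrE ?fnorm_ge0 ?(ltW (s0 c)) // fnorm_sq.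
rewrite -mulmxA sqnorm_isometry // sqnorm_mul_trmx_isometry //.
apply: le_trans (sqnorm_row_le _ c); rewrite sqnorm_rV (bigD1 c) //=.
by rewrite !mxE eqxx mulr1n lerDl sumr_ge0 // => *; exact: sqr_ge0.
Qed.

End Bounds.

Lemma orthonormal_row_bound_gt0 a r (U : 'M[R]_(a, r)) mu : (0 < r)%N ->
  orthonormal_cols U -> (forall i, row_norm2 U i <= mu) -> 0 < mu.
Proof.
move=> r0 UU rows_le; rewrite ltNge; apply/negP => mu_le0.
have : sqnorm U <= 0.
  rewrite sqnorm_rows; apply: sumr_le0 => i _; rewrite -row_norm2E.
  exact: le_trans (rows_le i) mu_le0.
by rewrite sqnorm_orthonormal_cols // lern0; case: r r0 {U UU rows_le}.
Qed.

Lemma is_top_projection_eigvecs n r (Z : 'M[R]_n) (U : 'M[R]_(n, r)) :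
  (r <= n)%N -> top_eigvecs Z U -> is_top_projection r Z (U *m U^T).
Proof.
move=> rn [V [lam [VV VZ lam_sorted UV]]]; exists V, lam; split; first by split.
suff -> : U = topcols r V by [].
apply/matrixP => i c; rewrite (UV i c (widen_ord rn c)) //.
by rewrite (mul_mx_pidE r V i (k := widen_ord rn c)) ?ltn_ord.
Qed.

End CompactSVD.

Section WedgeSpectrum.
Variables (R : realType) (n m r : nat) (A : 'M[R]_(n, m)).
Variables (U : 'M[R]_(n, r)) (s : 'rV[R]_r) (V : 'M[R]_(m, r)).
Variables (S nuU nuV p : R) (K : nat).
Hypotheses (svd : compact_svd A U s V) (s_le : forall c, s 0 c <= S).
Hypotheses (S0 : 0 < S) (nuU0 : 0 < nuU) (nuV0 : 0 < nuV).
Hypothesis rowU : forall i, row_norm2 U i <= nuU.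
Hypothesis rowV : forall l, row_norm2 V l <= nuV.
Hypotheses (p01 : 0 < p <= 1) (K0 : (0 < K)%N).

Definition entry_sq_bound : R := S ^+ 2 * nuU * nuV.

Definition noise_level : R := Num.sqrt (tail_level K (S ^+ 2 * entry_sq_bound / p)).

Definition loo_projection (i : 'I_n) (w : wsample n m) : 'M[R]_n :=
  top_projection r (A *m A^T + compress i (wedge_noise A p w)).

Definition good_sample (w : wsample n m) : Prop :=
  opnorm_le (wedge_noise A p w) noise_level /\
  forall i, fnorm (row i (wedge_noise A p w *m loo_projection i w))
            <= noise_level * rowmax (loo_projection i w).

Let p0 : 0 < p. Proof. by case/andP: p01. Qed.

Let p01W : 0 <= p <= 1. Proof. exact: gt0_le1W. Qed.

Let entry_sq_bound_gt0 : 0 < entry_sq_bound. Proof. by rewrite !mulr_gt0 ?exprn_gt0. Qed.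

Let variance_gt0 : 0 < S ^+ 2 * entry_sq_bound / p.
Proof. by rewrite divr_gt0 // mulr_gt0 ?exprn_gt0. Qed.

Lemma noise_level_sq : noise_level ^+ 2 = tail_level K (S ^+ 2 * entry_sq_bound / p).
Proof. by rewrite sqr_sqrtr // tail_level_ge0 // ltW. Qed.

Lemma entry_sq_le i l : A i l ^+ 2 <= entry_sq_bound.
Proof.
apply: le_trans (entry_svd_le svd s_le i l) _.
rewrite /entry_sq_bound -!(mulrA (S ^+ 2)); apply: ler_wpM2l; first exact: sqr_ge0.
by apply: ler_pM; rewrite ?sqnorm_ge0 -?row_norm2E.
Qed.

Lemma wedge_entry_sq_le a b l : (A a l * A b l) ^+ 2 <= entry_sq_bound ^+ 2.
Proof. by rewrite exprMn (expr2 entry_sq_bound) ler_pM ?sqr_ge0 ?entry_sq_le. Qed.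

Lemma sum_wedge_entry_sq_le a :
  \sum_b \sum_l (A a l * A b l) ^+ 2 <= S ^+ 2 * entry_sq_bound.
Proof.
have S2_ge0 : 0 <= S ^+ 2 := sqr_ge0 S.
have col_le l : \sum_b A b l ^+ 2 <= S ^+ 2 * nuV.
  have := sqnorm_row_svd_le (compact_svd_tr svd) s_le l; rewrite sqnorm_rV -row_norm2E.
  under eq_bigr do rewrite !mxE.
  by move/le_trans; apply; exact: ler_wpM2l.
have row_le : \sum_l A a l ^+ 2 <= S ^+ 2 * nuU.
  have := sqnorm_row_svd_le svd s_le a; rewrite sqnorm_rV -row_norm2E.
  under eq_bigr do rewrite !mxE.
  by move/le_trans; apply; exact: ler_wpM2l.
rewrite exchange_big /=; apply: le_trans (_ : \sum_l A a l ^+ 2 * (S ^+ 2 * nuV) <= _).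
  apply: ler_sum => l _; under eq_bigr do rewrite exprMn.
  by rewrite -mulr_sumr; apply: ler_wpM2l; [exact: sqr_ge0|exact: col_le].
have -> : S ^+ 2 * entry_sq_bound = S ^+ 2 * nuU * (S ^+ 2 * nuV) by rewrite /entry_sq_bound; ring.
by rewrite -mulr_suml; apply: ler_wpM2r => //; rewrite mulr_ge0 // ltW.
Qed.

Hypothesis K_entry_le : K%:R * entry_sq_bound / p <= S ^+ 2.

Lemma wedge_row_proxy i :
  variance_proxy p K (fun x => sqnorm (row i (wedge_mx A x))) (S ^+ 2 * entry_sq_bound / p).
Proof.
split=> [|x].
  rewrite ler_pM2r ?invr_gt0 //; apply: le_trans (sum_sqnorm_row_wedge_mx_le _ _) _.
  exact: sum_wedge_entry_sq_le.
apply: le_trans (_ : K%:R * (entry_sq_bound ^+ 2 / p ^+ 2) <= _).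
  apply: ler_wpM2l; first exact: ler0n.
  rewrite ler_pM2r ?invr_gt0 ?exprn_gt0 //; apply: sqnorm_row_wedge_mx_le.
  exact: wedge_entry_sq_le.
have -> : K%:R * (entry_sq_bound ^+ 2 / p ^+ 2) = K%:R * entry_sq_bound / p * (entry_sq_bound / p).
  by field; exact: lt0r_neq0.
by rewrite -[leRHS]mulrA; apply: ler_wpM2r => //; rewrite divr_ge0 // ltW.
Qed.

Lemma prob_opnorm_bad :
  prob p (fun w : wsample n m => ~ opnorm_le (wedge_noise A p w) noise_level)
  <= n%:R ^+ 2 * expR (- K%:R).
Proof.
apply: matrix_tail => //; [exact: wedge_mxT|exact: wedge_mx_sq_diag|exact: wedge_row_proxy].
Qed.

Lemma wedge_row_tail i (Q : 'M[R]_n) :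
  prob p (fun w : wsample n m =>
    noise_level * rowmax Q < fnorm (row i (wedge_noise A p w) *m Q)) <= expR (- K%:R).
Proof.
have proxy : variance_proxy p K (fun x => sqnorm (row i (wedge_mx A x) *m Q))
    (S ^+ 2 * entry_sq_bound / p * rowmax Q ^+ 2).
  apply: variance_proxy_scale (wedge_row_proxy i) => // [|x]; first exact: sqr_ge0.
  by apply: sqnorm_single_support_mul_le; exact: row_wedge_mx_single_support.
have v0 : 0 <= S ^+ 2 * entry_sq_bound / p * rowmax Q ^+ 2.
  by rewrite mulr_ge0 ?sqr_ge0 // ltW.
apply: le_trans (vector_tail K0 p01 v0 proxy); apply: prob_le => // w.
rewrite -row_wedge_noise_mul tail_levelM -noise_level_sq -exprMn -fnorm_sq.
by rewrite ltr_sqr ?nnegrE ?fnorm_ge0 // mulr_ge0 ?rowmax_ge0 ?sqrtr_ge0.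
Qed.

(* Conditionally on the wedges not touching [i] the matrix [loo_projection i w] is
   frozen, whereas row [i] of the noise only involves the wedges touching [i]. *)
Lemma prob_row_bad i :
  prob p (fun w : wsample n m => noise_level * rowmax (loo_projection i w) <
    fnorm (row i (wedge_noise A p w *m loo_projection i w))) <= expR (- K%:R).
Proof.
rewrite /prob (expect_resample p (touches i)) -[leRHS](expect_cst ('I_n * 'I_m * 'I_n)%type p).
apply: expect_le => // w'; apply: le_trans (wedge_row_tail i (loo_projection i w')).
apply: (@prob_le _ _ _ p01W (fun w => noise_level *
    rowmax (loo_projection i (splice (touches i) w w')) <
    fnorm (row i (wedge_noise A p (splice (touches i) w w') *m
      loo_projection i (splice (touches i) w w'))))) => w.
by rewrite /loo_projection compress_wedge_noise_splice row_mul row_wedge_noise_splice.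
Qed.

Lemma prob_bad_sample :
  prob p (fun w => ~ good_sample w) <= (n%:R ^+ 2 + n%:R) * expR (- K%:R).
Proof.
rewrite mulrDl; apply: le_trans (lerD prob_opnorm_bad (_ : prob p (fun w => exists i,
    noise_level * rowmax (loo_projection i w) <
    fnorm (row i (wedge_noise A p w *m loo_projection i w))) <= _)); last first.
  by have := prob_exists p01W prob_row_bad; rewrite card_ord.
apply: le_trans (prob_or p01W _ _); apply: prob_le => // w.
move=> /not_andP[opnorm_bad|rows_bad]; [by left|right].
by have /existsNP[i row_bad] := rows_bad; exists i; rewrite ltNge; apply/negP.
Qed.

Section GoodSample.
Variables (sig : R) (w : wsample n m).
Hypotheses (rn : (r <= n)%N) (sig0 : 0 < sig) (sig_le : forall c, sig <= s 0 c ^+ 2).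
Hypotheses (small_noise : noise_level <= sig / 20) (w_good : good_sample w).
Let Z := wedge_matrix p A w.
Let Q := top_projection r Z.

Let UU : orthonormal_cols U. Proof. by case: svd. Qed.

Let level0 : 0 <= noise_level := sqrtr_ge0 _.

Let gap : 2 * noise_level < sig. Proof. by move: sig0 small_noise; lra. Qed.

Let d_ge c : sig <= (\row_c s 0 c ^+ 2) 0 c. Proof. by rewrite mxE. Qed.

Let ZE : Z = U *m diag_mx (\row_c s 0 c ^+ 2) *m U^T + wedge_noise A p w.
Proof. by rewrite /Z wedge_matrixE (compact_svd_gram svd). Qed.

Let topQ : is_top_projection r (U *m diag_mx (\row_c s 0 c ^+ 2) *m U^T + wedge_noise A p w) Q.
Proof. by rewrite -ZE; apply: top_projectionP; exact: wedge_matrixT. Qed.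

Lemma good_sample_top_eigvecs (U' : 'M[R]_(n, r)) : top_eigvecs Z U' -> U' *m U'^T = Q.
Proof.
move=> /(is_top_projection_eigvecs rn); rewrite ZE => topU'.
exact: (top_projection_unique rn UU d_ge level0 gap (proj1 w_good) topU' topQ).
Qed.

Lemma good_sample_row_le i : fnorm (row i Q) <= 2 * (S ^+ 2 * Num.sqrt nuU) / sig.
Proof.
have [opnorm_w rows_w] := w_good.
have bound_ge0 : 0 <= S ^+ 2 * Num.sqrt nuU by nonneg.
apply: (leave_one_out (Q_ := loo_projection^~ w) rn UU d_ge sig0 level0 small_noise opnorm_w topQ).
- move=> j; rewrite -(compact_svd_gram svd); apply: top_projectionP.
  by rewrite linearD /= trmx_mul trmxK compressT // wedge_noiseT.
- by move=> j; apply: le_trans (rows_w j) _; apply: ler_wpM2r; [exact: rowmax_ge0|].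
- exact: bound_ge0.
move=> j; rewrite fnorm_le // exprMn sqr_sqrtr ?(ltW nuU0) // row_mul.
rewrite sqnorm_mul_trmx_isometry // row_mul.
apply: le_trans (_ : S ^+ 2 ^+ 2 * sqnorm (row j U) <= _).
  apply: sqnorm_mul_diag_le => c; rewrite mxE ler_sqr ?nnegrE ?sqr_ge0 //.
  exact: singular_value_sq_le svd s_le c.
by apply: ler_wpM2l; [exact: sqr_ge0|rewrite -row_norm2E].
Qed.

Lemma good_sample_bias_le :
  fnorm ((1%:M - Q) *m U) <= 2 * Num.sqrt r%:R * noise_level / sig.
Proof.
have bias_le := top_projection_compl_le rn UU d_ge level0 gap (proj1 w_good) topQ.
rewrite ler_pdivlMr // -ler_sqr ?nnegrE ?mulr_ge0 ?fnorm_ge0 ?sqrtr_ge0 ?(ltW sig0) //.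
rewrite !exprMn fnorm_sq sqr_sqrtr ?ler0n //.
have gap_ge : (sig / 2) ^+ 2 <= (sig - noise_level) ^+ 2.
  by have := small_noise; have := sig0 => ? ?; rewrite ler_sqr ?nnegrE; lra.
have := le_trans (ler_wpM2r (sqnorm_ge0 ((1%:M - Q) *m U)) gap_ge) bias_le.
by rewrite exprMn; lra.
Qed.

End GoodSample.
End WedgeSpectrum.

Section Constants.
Variable R : realType.

Lemma ln2_ge_half : 1 / 2 <= ln 2 :> R.
Proof.
rewrite -[leLHS]expRK ler_ln ?posrE ?expR_gt0 //.
by have := @expR_le1D2x R (1 / 2); lra.
Qed.

Lemma moment_order_exists (a : R) n : 2 <= a -> (1 < n)%N -> exists K : nat,
  [/\ (0 < K)%N, K%:R <= 3 * (a * ln n%:R) & n%:R ^+ 2 * expR (- K%:R) <= n%:R `^ (- a)].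
Proof.
move=> a2 n1; have n0 : 0 < n%:R :> R by rewrite ltr0n (ltn_trans _ n1).
set L := ln n%:R; have L2 : 1 / 2 <= L.
  by apply: le_trans ln2_ge_half _; rewrite ler_ln ?posrE // ler_nat.
have aL0 : 0 <= (a + 2) * L by apply: mulr_ge0; lra.
have /andP[trunc_le trunc_gt] := truncn_itv aL0.
exists (Num.truncn ((a + 2) * L)).+1; split => //.
  by rewrite -natr1; nra.
rewrite /powR gt_eqF // -[n%:R in X in X * _](lnK (_ : n%:R \in Num.pos)) ?posrE //.
by rewrite -expRM_natl -expRD ler_expR -/L; lra.
Qed.

Lemma powR_half_sq (x : R) k : 0 < x -> (x `^ (3 / 2 + k%:R / 2)) ^+ 2 = x ^+ (k + 3).
Proof.
move=> x0; rewrite expr2 -powRD; last by rewrite gt_eqF // implybT.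
by rewrite -powR_mulrn ?ltW // natrD; congr powR; lra.
Qed.

Lemma expr_sq_scaled_sqrt (x y : R) k : 0 <= y ->
  ((2 * (x ^+ 2 * Num.sqrt y)) ^+ 2) ^+ k = (2 ^+ k) ^+ 2 * (x ^+ (2 * k)) ^+ 2 * y ^+ k.
Proof.
move=> y0; have -> : (2 * (x ^+ 2 * Num.sqrt y)) ^+ 2 = 2 ^+ 2 * (x ^+ 2) ^+ 2 * y.
  by rewrite exprMn [(_ * Num.sqrt y) ^+ 2]exprMn sqr_sqrtr // mulrA.
by rewrite exprMn [(_ * (x ^+ 2) ^+ 2) ^+ k]exprMn (exprM x) !(exprAC _ 2 k).
Qed.

Lemma sqrt_tail_level_le K (x v : R) : K%:R <= 3 * x -> 0 <= v ->
  Num.sqrt (tail_level K v) <= 7 / 2 * expR 2 * Num.sqrt (x * v).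
Proof.
move=> Kx v0; have x0 : 0 <= x by have := ler0n R K; lra.
(* [12 e^3 <= (7/2 e^2)^2] *)
have e2_ge0 := expR_ge0 (2 : R); have e3_ge0 := expR_ge0 (3 : R).
rewrite -ler_sqr ?nnegrE ?sqrtr_ge0 //.
rewrite sqr_sqrtr ?tail_level_ge0 // !exprMn sqr_sqrtr; last by nonneg.
have -> : expR 2 ^+ 2 = expR 4 :> R by rewrite expr2 -expRD; congr expR; lra.
have e34 : expR 3 <= expR 4 :> R by rewrite ler_expR; lra.
have K_le := ler_wpM2r v0 (ler_wpM2l e3_ge0 Kx).
have := ler_wpM2r (mulr_ge0 x0 v0) e34; rewrite /tail_level.
by have := mulr_ge0 e3_ge0 (mulr_ge0 x0 v0); lra.
Qed.

End Constants.

Section IncoherentSVD.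
Variable R : realType.

Lemma incoherent_row_norm2_le k n (T : mindex k n -> R) mu1 mu2 (j : 'I_k)
    (r := \rank (unfold j T)) (U : 'M[R]_(n, r)) s (V : 'M[R]_(ncol k n, r)) :
  incoherent T mu1 mu2 -> compact_svd (unfold j T) U s V ->
  (forall i, row_norm2 U i <= mu1 * r%:R / n%:R) /\
  (forall l, row_norm2 V l <= mu2 * r%:R / (ncol k n)%:R).
Proof.
move=> /(_ j)[U' [s' [V' [svd' [rowU' rowV']]]]] svd; split=> i.
  by rewrite row_norm2_gram (compact_svd_left_gram_uniq svd svd') -row_norm2_gram.
have svdT := compact_svd_tr svd; have svdT' := compact_svd_tr svd'.
by rewrite row_norm2_gram (compact_svd_left_gram_uniq svdT svdT') -row_norm2_gram.
Qed.

Lemma cond_number_svd a b (M : 'M[R]_(a, b)) kappa : (0 < \rank M)%N -> cond_number M kappa ->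
  exists (U : 'M[R]_(a, \rank M)) s (V : 'M[R]_(b, \rank M)) (cmax cmin : 'I_(\rank M)),
    [/\ compact_svd M U s V, forall c, s 0 cmin <= s 0 c <= s 0 cmax
      & kappa = s 0 cmax / s 0 cmin].
Proof.
move=> r0 [U [s [V [svd kappaE]]]]; have last_lt : ((\rank M).-1 < \rank M)%N by rewrite prednK.
exists U, s, V, (Ordinal r0), (Ordinal last_lt); split=> // [c|]; last exact: kappaE.
by case: svd => _ _ _ s_sorted _; rewrite !s_sorted // /= -ltnS prednK.
Qed.

End IncoherentSVD.

Section Recovery.
Variables (R : realType) (k n r : nat) (hk : (1 < k)%N) (T : mindex k n -> R).
Variables (a L mu1 mu2 p q : R) (K : nat).
Variables (U : 'M[R]_(n, r)) (s : 'rV[R]_r) (V : 'M[R]_(ncol k n, r)) (cmax cmin : 'I_r).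
Local Notation A := (unfold (mode1 hk) T).
Local Notation S := (s 0 cmax).
Local Notation smin := (s 0 cmin).
Local Notation kappa := (S / smin).
Local Notation nuU := (mu1 * r%:R / n%:R).
Local Notation nuV := (mu2 * r%:R / (ncol k n)%:R).
Local Notation level := (noise_level S nuU nuV p K).
Hypotheses (n0 : (0 < n)%N) (Tsym : symmetric_tensor T) (svd : compact_svd A U s V).
Hypothesis s_itv : forall c, smin <= s 0 c <= S.
Hypotheses (rowU : forall i, row_norm2 U i <= nuU) (rowV : forall l, row_norm2 V l <= nuV).
Hypotheses (p01 : 0 < p <= 1) (q01 : 0 < q <= 1).
Hypotheses (K0 : (0 < K)%N) (K_le : K%:R <= 3 * (a * L)).
Hypothesis p_ge :
  4800 * expR 3 * kappa ^+ 4 * a * mu1 * mu2 * r%:R ^+ 2 * L / n%:R ^+ k <= p.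
Hypothesis q_ge : a * (k%:R - 1) * L / n%:R ^+ k <= q.

Definition bias_rate : R :=
  k%:R * Num.sqrt r%:R * kappa ^+ 2 *
  Num.sqrt (a * mu1 * mu2 * r%:R ^+ 2 * L / (p * n%:R ^+ k)).

Definition sampling_rate : R :=
  2 ^+ k * r%:R `^ (3 / 2 + k%:R / 2) * kappa ^+ (2 * k) *
  Num.sqrt (a * (k%:R - 1) * mu1 ^+ k.+1 * mu2 * L / (q * n%:R ^+ k)).

(* [S ^+ 2 * rho] bounds the squared entries of [T]. *)
Let rho : R := mu1 * mu2 * r%:R ^+ 2 / n%:R ^+ k.
Let row_bound : R := 2 * (kappa ^+ 2 * Num.sqrt nuU).

Let p0 : 0 < p. Proof. by case/andP: p01. Qed.
Let q0 : 0 < q. Proof. by case/andP: q01. Qed.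
Let nR0 : 0 < n%:R :> R. Proof. by rewrite ltr0n. Qed.
Let nk0 : 0 < n%:R ^+ k :> R. Proof. by rewrite exprn_gt0. Qed.
Let r0 : (0 < r)%N. Proof. exact: leq_ltn_trans (ltn_ord cmax). Qed.
Let rR0 : 0 < r%:R :> R. Proof. by rewrite ltr0n. Qed.
Let UU : orthonormal_cols U. Proof. by case: svd. Qed.
Let S0 : 0 < S. Proof. by case: svd. Qed.
Let smin0 : 0 < smin. Proof. by case: svd. Qed.
Let kappa0 : 0 < kappa. Proof. by rewrite divr_gt0. Qed.
Let s_le c : s 0 c <= S. Proof. by case/andP: (s_itv c). Qed.

Let ncolE : n%:R * (ncol k n)%:R = n%:R ^+ k :> R.
Proof.
by rewrite /ncol card_ffun !card_ord -natrM -expnS prednK ?natrX // (ltn_trans _ hk).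
Qed.

Let ncol0 : 0 < (ncol k n)%:R :> R. Proof. by rewrite -(pmulr_rgt0 _ nR0) ncolE. Qed.

Let nuU0 : 0 < nuU. Proof. exact: orthonormal_row_bound_gt0 rowU. Qed.

Let nuV0 : 0 < nuV.
Proof. by case: svd => _ VV _ _ _; exact: orthonormal_row_bound_gt0 rowV. Qed.

Let mu1_gt0 : 0 < mu1.
Proof. by move: nuU0; rewrite pmulr_lgt0 ?invr_gt0 // pmulr_lgt0. Qed.

Let mu2_gt0 : 0 < mu2.
Proof. by move: nuV0; rewrite pmulr_lgt0 ?invr_gt0 // pmulr_lgt0. Qed.

Let rho0 : 0 < rho. Proof. by rewrite divr_gt0 ?mulr_gt0 ?exprn_gt0. Qed.

Let aL0 : 0 <= a * L. Proof. by have := ler0n R K; move: K_le; lra. Qed.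

Let entry_sq_boundE : entry_sq_bound S nuU nuV = S ^+ 2 * rho.
Proof. by rewrite /entry_sq_bound /rho -ncolE; field; rewrite !gt_eqF. Qed.

Let S_sq : S ^+ 2 = kappa ^+ 2 * smin ^+ 2.
Proof. by field; rewrite gt_eqF. Qed.

Lemma noise_levelE : level = kappa ^+ 2 * smin ^+ 2 * Num.sqrt (tail_level K (rho / p)).
Proof.
rewrite /noise_level entry_sq_boundE -S_sq.
have -> : S ^+ 2 * (S ^+ 2 * rho) / p = rho / p * (S ^+ 2) ^+ 2 by ring.
by rewrite tail_levelM mulrC sqrtrM ?sqr_ge0 // sqrtr_sqr ger0_norm ?sqr_ge0.
Qed.

Let kappa_ge1 : 1 <= kappa ^+ 4.
Proof. by rewrite exprn_ege1 // ler_pdivlMr // mul1r; case/andP: (s_itv cmax). Qed.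

Let e3_ge1 : 1 <= expR 3 :> R. Proof. by rewrite -expR0 ler_expR. Qed.

Let p_ge_rho : 4800 * (expR 3 * kappa ^+ 4 * (a * L * rho)) <= p.
Proof. by move: p_ge; rewrite /rho; lra. Qed.

Lemma moment_order_variance_le : K%:R * entry_sq_bound S nuU nuV / p <= S ^+ 2.
Proof.
rewrite entry_sq_boundE ler_pdivrMr // mulrCA; apply: ler_wpM2l; first exact: sqr_ge0.
have aLrho0 : 0 <= a * L * rho by rewrite mulr_ge0 // ltW.
have := ler_wpM2r (ltW rho0) K_le; have := p_ge_rho.
have : 1 * 1 <= expR 3 * kappa ^+ 4 by apply: ler_pM.
by move/(ler_wpM2r aLrho0); lra.
Qed.

Lemma noise_level_small : level <= smin ^+ 2 / 20.
Proof.
suff ratio : kappa ^+ 2 * Num.sqrt (tail_level K (rho / p)) <= 1 / 20.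
  by rewrite noise_levelE; have := ler_wpM2l (sqr_ge0 smin) ratio; lra.
have ratio_ge0 : 0 <= kappa ^+ 2 * Num.sqrt (tail_level K (rho / p)).
  by rewrite mulr_ge0 ?sqr_ge0 ?sqrtr_ge0.
rewrite -ler_sqr ?nnegrE // exprMn sqr_sqrtr; last by rewrite tail_level_ge0 // divr_ge0 ?ltW.
have -> : kappa ^+ 2 ^+ 2 * tail_level K (rho / p) =
    4 * (expR 3 * kappa ^+ 4 * rho * K%:R) / p by rewrite /tail_level; ring.
rewrite ler_pdivrMr //.
have kappa4_ge0 : 0 <= expR 3 * kappa ^+ 4 * rho.
  by nonneg.
by have := ler_wpM2l kappa4_ge0 K_le; have := p_ge_rho; lra.
Qed.

Let sig0 : 0 < smin ^+ 2. Proof. by rewrite exprn_gt0. Qed.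

Let sig_le c : smin ^+ 2 <= s 0 c ^+ 2.
Proof. by case/andP: (s_itv c) => s_ge _; rewrite lerXn2r // nnegrE ltW //; case: svd. Qed.

Let rn : (r <= n)%N. Proof. exact: mulmx1_min UU. Qed.

Let Q (w : wsample n (ncol k n)) := top_projection r (wedge_matrix p A w).

Section GoodSample.
Variable w : wsample n (ncol k n).
Hypothesis w_good : good_sample r A S nuU nuV p K w.

Let Qproj : orthoproj (Q w).
Proof. exact: orthoproj_top_projection rn (wedge_matrixT _ _ _). Qed.

Lemma recovery_bias_le :
  fnorm (tvec T - kron (fun=> Q w) *m tvec T) <= 7 * expR 2 * bias_rate * frob T.
Proof.
apply: le_trans (tensor_bias_le Tsym Qproj UU (compact_svd_absorb svd)) _.
rewrite mulrA; apply: ler_wpM2r; first exact: sqrtr_ge0.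
have bias_le := good_sample_bias_le svd rn sig0 sig_le noise_level_small w_good.
have tail_le := sqrt_tail_level_le K_le (divr_ge0 (ltW rho0) (ltW p0)).
apply: le_trans (ler_wpM2l (ler0n R k) bias_le) _; rewrite noise_levelE.
have -> : k%:R * (2 * Num.sqrt r%:R * (kappa ^+ 2 * smin ^+ 2 *
    Num.sqrt (tail_level K (rho / p))) / smin ^+ 2) =
    2 * (k%:R * Num.sqrt r%:R * kappa ^+ 2) * Num.sqrt (tail_level K (rho / p)).
  by move: (Num.sqrt (tail_level _ _)) (Num.sqrt r%:R) => tail sqrt_r; field; rewrite gt_eqF.
have coef_ge0 : 0 <= 2 * (k%:R * Num.sqrt r%:R * kappa ^+ 2) by nonneg.
apply: le_trans (ler_wpM2l coef_ge0 tail_le) _; rewrite /bias_rate.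
have -> : a * L * (rho / p) = a * mu1 * mu2 * r%:R ^+ 2 * L / (p * n%:R ^+ k).
  by rewrite /rho; field; rewrite !gt_eqF.
by move: (Num.sqrt _) => ?; lra.
Qed.

Let kR1 : 1 <= k%:R - 1 :> R.
Proof. by rewrite lerBrDr (_ : 1 + 1 = 2%:R) ?ler_nat. Qed.

Let rR1 : 1 <= r%:R :> R. Proof. by rewrite ler1n. Qed.

Let row_bound0 : 0 <= row_bound.
Proof. by rewrite /row_bound; nonneg. Qed.

Let sampling_variance : R :=
  (2 ^+ k) ^+ 2 * (kappa ^+ (2 * k)) ^+ 2 * mu1 ^+ k.+1 * mu2 * r%:R ^+ k.+2 / (q * n%:R ^+ k).

Let sampling_variance0 : 0 <= sampling_variance.
Proof. by rewrite /sampling_variance; nonneg. Qed.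

Lemma sampling_varianceE :
  3 * n%:R ^+ k * (S ^+ 2 * rho * (row_bound ^+ 2) ^+ k) / q = 3 * S ^+ 2 * sampling_variance.
Proof.
have -> : (row_bound ^+ 2) ^+ k =
    (2 ^+ k) ^+ 2 * (kappa ^+ (2 * k)) ^+ 2 * (mu1 ^+ k * r%:R ^+ k / n%:R ^+ k).
  rewrite expr_sq_scaled_sqrt ?(ltW nuU0) //.
  by rewrite [(mu1 * _ / _) ^+ k]expr_div_n [(mu1 * _) ^+ k]exprMn.
rewrite /sampling_variance /rho (exprS mu1) (exprS r%:R k.+1) (exprS r%:R k).
move: (kappa ^+ (2 * k)) => kap; field.
by rewrite !gt_eqF.
Qed.

Lemma sampling_rate_sq : sampling_rate ^+ 2 = a * L * (k%:R - 1) * r%:R * sampling_variance.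
Proof.
rewrite /sampling_rate 3!exprMn powR_half_sq // sqr_sqrtr.
  rewrite /sampling_variance addn3 (exprS r%:R k.+2).
  by move: (r%:R ^+ k.+2) (kappa ^+ (2 * k)) (mu1 ^+ k.+1) (2 ^+ k : R) => rk kap mu two; ring.
have -> : a * (k%:R - 1) * mu1 ^+ k.+1 * mu2 * L = a * L * (k%:R - 1) * mu1 ^+ k.+1 * mu2 by ring.
have k10 : 0 <= k%:R - 1 :> R := le_trans ler01 kR1.
by nonneg.
Qed.

Lemma sampling_level_le :
  Num.sqrt (tail_level K (3 * S ^+ 2 * sampling_variance)) <=
  7 * expR 2 * sampling_rate * frob T.
Proof.
have variance_ge0 : 0 <= 3 * S ^+ 2 * sampling_variance.
  by nonneg.
apply: le_trans (sqrt_tail_level_le K_le variance_ge0) _.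
have rate_ge0 : 0 <= sampling_rate.
  by rewrite /sampling_rate !mulr_ge0 ?powR_ge0 ?sqrtr_ge0 ?exprn_ge0 // ltW.
suff : Num.sqrt (a * L * (3 * S ^+ 2 * sampling_variance)) <= 2 * (sampling_rate * frob T).
  by move/(ler_wpM2l (expR_ge0 (2 : R))); lra.
have frob0 : 0 <= frob T := sqrtr_ge0 _.
have bound_ge0 : 0 <= 2 * (sampling_rate * frob T) by nonneg.
rewrite -ler_sqr ?nnegrE ?sqrtr_ge0 // sqr_sqrtr; last exact: mulr_ge0.
rewrite 2!exprMn sampling_rate_sq.
have S_le : S ^+ 2 <= frob T ^+ 2.
  rewrite ler_sqr ?nnegrE ?(ltW S0) // -(fnorm_unfold (mode1 hk)).
  exact: singular_value_le_fnorm svd _.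
have kr_ge1 : 1 * 1 <= (k%:R - 1) * r%:R :> R by apply: ler_pM.
have scale_le : 1 * 1 * S ^+ 2 <= (k%:R - 1) * r%:R * frob T ^+ 2.
  by apply: ler_pM => //; exact: sqr_ge0.
have := ler_wpM2l (mulr_ge0 aL0 sampling_variance0) scale_le.
have := mulr_ge0 (mulr_ge0 aL0 sampling_variance0) (sqr_ge0 S).
by lra.
Qed.

Lemma prob_sampling_bad :
  prob q (fun e : esample k n => 7 * expR 2 * sampling_rate * frob T <
    fnorm (kron (fun=> Q w) *m tvec T - kron (fun=> Q w) *m tvec (rescaled_sample T q e)))
  <= expR (- K%:R).
Proof.
have q01W := gt0_le1W q01.
have Q_row i : fnorm (row i (Q w)) <= row_bound.
  have := good_sample_row_le svd s_le nuU0 rowU rn sig0 sig_le noise_level_small w_good i.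
  rewrite S_sq (_ : _ / _ = row_bound) //; rewrite /row_bound.
  by move: (Num.sqrt _) => ?; field; rewrite gt_eqF.
have T_le f : T f ^+ 2 <= S ^+ 2 * rho.
  by rewrite -(unfoldK (mode1 hk) T) -entry_sq_boundE; exact: entry_sq_le svd s_le rowU rowV _ _.
have K_sample : K%:R <= 3 * (q * n%:R ^+ k).
  move: q_ge; rewrite ler_pdivrMr // => aL_le; have := ler_wpM2l aL0 kR1.
  by move: K_le; lra.
have S2rho0 : 0 <= S ^+ 2 * rho by nonneg.
apply: le_trans (sampling_noise_tail K0 q01 S2rho0 row_bound0 (proj1 Qproj) Q_row T_le K_sample).
apply: prob_le => // e; rewrite sampling_varianceE => noise_gt.
rewrite ltNge; apply/negP => noise_le; move: noise_gt; rewrite ltNge => /negP; apply.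
by apply: le_trans sampling_level_le; rewrite ler_wsqrtr.
Qed.

Lemma recovery_error_le e (Uhat : 'M[R]_(n, r)) : top_eigvecs (wedge_matrix p A w) Uhat ->
  ~ 7 * expR 2 * sampling_rate * frob T <
    fnorm (kron (fun=> Q w) *m tvec T - kron (fun=> Q w) *m tvec (rescaled_sample T q e)) ->
  frob (fun f => T f - estimator hk T q Uhat e f) <=
  7 * expR 2 * (bias_rate + sampling_rate) * frob T.
Proof.
move=> /(good_sample_top_eigvecs svd rn sig0 sig_le noise_level_small w_good) UhatE.
move=> /negP; rewrite -leNgt => noise_le; apply: le_trans (estimator_error_le _ _ _ _ _) _.
by rewrite UhatE mulrDr mulrDl; apply: lerD => //; exact: recovery_bias_le.
Qed.

End GoodSample.

Lemma recovery_probability_ge (delta : R) : n%:R ^+ 2 * expR (- K%:R) <= delta ->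
  1 - 3 * delta <= prob2 p q (fun (w : wsample n (ncol k n)) (e : esample k n) =>
    forall Uhat : 'M[R]_(n, r), top_eigvecs (wedge_matrix p A w) Uhat ->
      frob (fun f => T f - estimator hk T q Uhat e f) <=
      7 * expR 2 * (bias_rate + sampling_rate) * frob T).
Proof.
move=> delta_ge; have eK0 := expR_ge0 (- K%:R : R).
have n_ge1 : 1 <= n%:R :> R by rewrite ler1n.
have n_le : n%:R * expR (- K%:R) <= n%:R ^+ 2 * expR (- K%:R) :> R.
  by apply: ler_wpM2r => //; exact: ler_eXnr.
have e_le : expR (- K%:R) <= n%:R * expR (- K%:R) :> R by rewrite ler_peMl.
have delta0 : 0 <= delta by lra.
have p01W := gt0_le1W p01.
have q01W := gt0_le1W q01.
have bad_le : prob p (fun w => ~ good_sample r A S nuU nuV p K w) <= 2 * delta.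
  apply: le_trans (prob_bad_sample svd s_le S0 nuU0 nuV0 rowU rowV p01 K0
    moment_order_variance_le) _.
  by rewrite mulrDl; lra.
have -> : 3 * delta = delta + 2 * delta by ring.
apply: (prob2_ge p01W q01W delta0 bad_le) => w w_good.
apply: (@le_trans _ _ (expR (- K%:R))); last by lra.
apply: le_trans (prob_sampling_bad w_good); apply: prob_le => // e.
apply: contra_notP => noise_le Uhat topUhat; exact: (recovery_error_le w_good topUhat noise_le).
Qed.

End Recovery.

Lemma frob_eq0 (R : realType) k n (T : mindex k n -> R) : (forall f, T f = 0) -> frob T = 0.
Proof.
move=> T0; rewrite frob_tvec (_ : tvec T = 0) ?fnorm0 //.
by apply/matrixP => c o; rewrite !mxE T0.
Qed.

Lemma estimator_eq0 (R : realType) k n r (hk : (1 < k)%N) (T : mindex k n -> R) q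
    (U : 'M[R]_(n, r)) e f : (forall f, T f = 0) -> estimator hk T q U e f = 0.
Proof.
move=> T0; rewrite /estimator (_ : unfold _ _ = 0) ?mulmx0 ?mul0mx /fold ?mxE //.
by apply/matrixP => i c; rewrite !mxE T0 if_same mulr0.
Qed.

Lemma estimator_zero_error (R : realType) k n r (hk : (1 < k)%N) (T : mindex k n -> R) q
    (U : 'M[R]_(n, r)) e : unfold (mode1 hk) T = 0 ->
  frob (fun f => T f - estimator hk T q U e f) = 0 /\ frob T = 0.
Proof.
move=> A0; have T0 f : T f = 0 by rewrite -(unfoldK (mode1 hk) T) A0 /fold mxE.
by split; apply: frob_eq0 => // f; rewrite estimator_eq0 // T0 subrr.
Qed.

Theorem theorem4p1 (R : realType) (a : R) (ha : 2 <= a) :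
  exists C0 C C' : R, [/\ 0 < C0, 0 < C, 0 < C' &
  forall (k n r : nat) (hk : (1 < k)%N) (T : mindex k n -> R) (mu1 mu2 kappa p q : R),
    (1 < n)%N ->
    symmetric_tensor T ->
    incoherent T mu1 mu2 ->
    \rank (unfold (mode1 hk) T) = r ->
    cond_number (unfold (mode1 hk) T) kappa ->
    0 < p <= 1 -> 0 < q <= 1 ->
    C0 * kappa ^+ 4 * a * mu1 * mu2 * r%:R ^+ 2 * ln n%:R / n%:R ^+ k <= p ->
    a * (k%:R - 1) * ln n%:R / n%:R ^+ k <= q ->
    1 - C' * n%:R `^ (- a) <=
    prob2 p q (fun (w : wsample n (ncol k n)) (e : esample k n) =>
      forall U : 'M[R]_(n, r),
        top_eigvecs (wedge_matrix p (unfold (mode1 hk) T) w) U ->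
        frob (fun f => T f - estimator hk T q U e f) <=
        C * (k%:R * Num.sqrt r%:R * kappa ^+ 2 *
               Num.sqrt (a * mu1 * mu2 * r%:R ^+ 2 * ln n%:R / (p * n%:R ^+ k))
             + 2 ^+ k * r%:R `^ (3 / 2 + k%:R / 2) * kappa ^+ (2 * k) *
               Num.sqrt (a * (k%:R - 1) * mu1 ^+ k.+1 * mu2 * ln n%:R / (q * n%:R ^+ k)))
          * frob T)].
Proof.
(* [4800 = 4 * 20 ^ 2 * 3]: moments of order [K <= 3 a ln n] give
   [noise_level <= smin ^ 2 / 20]. *)
exists (4800 * expR 3), (7 * expR 2), 3.
have e2_gt0 := expR_gt0 (2 : R); have e3_gt0 := expR_gt0 (3 : R).
split; [lra | lra | lra |].
move=> k n r hk T mu1 mu2 kappa p q n1 Tsym inc <- cond p01 q01 p_ge q_ge.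
have [r0|r0] := posnP (\rank (unfold (mode1 hk) T)).
  rewrite prob2_always ?gerBl ?mulr_ge0 ?powR_ge0 // => w e U _.
  have A0 : unfold (mode1 hk) T = 0 by apply/eqP; rewrite -mxrank_eq0 r0.
  by have [-> ->] := estimator_zero_error q U e A0; rewrite mulr0.
have [K [K0 K_le K_tail]] := moment_order_exists ha n1.
have [U [s [V [cmax [cmin [svd s_itv kappaE]]]]]] := cond_number_svd r0 cond.
have [rowU rowV] := incoherent_row_norm2_le inc svd.
rewrite kappaE in p_ge *.
exact: (recovery_probability_ge (ltnW n1) Tsym svd s_itv rowU rowV p01 q01
  K0 K_le p_ge q_ge K_tail).
Qed.
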